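(* Let $\mathsf{Sch}$ be a schema (possibly with result-bounded access methods) whose integrity constraints $\Sigma$ are first-order sentences, and let $Q$ be a conjunctive query over the relational signature of $\mathsf{Sch}$. Then $Q$ is monotone answerable with respect to $\mathsf{Sch}$ if and only if $Q$ is access monotonically-determined over $\mathsf{Sch}$.
   Context: A schema consists of a relational signature, a set $\Sigma$ of integrity constraints given as first-order sentences (active-domain semantics, no constants), and a set of access methods. Each access method $\mathsf{mt}$ is associated with a relation $R$ and a subset of the positions of $R$ (its input positions); it may additionally have a result bound $k\in\mathbb{N}_{>0}$, or a result lower bound $k$. An access $(\mathsf{mt},b)$ on an instance $I$ consists of a method $\mathsf{mt}$ on $R$ and a binding $b$ mapping the input positions of $\mathsf{mt}$ to values of the active domain of $I$; its matching tuples $M$ are the tuples of $R$ in $I$ agreeing with $b$ on the input positions. A valid output is a subset $J\subseteq M$ such that: if $\mathsf{mt}$ has no bound, $J=M$; if $\mathsf{mt}$ has result bound $k$, then $|J|\le k$ and for every $j\le k$, $|M|\ge j$ implies $|J|\ge j$; if $\mathsf{mt}$ has result lower bound $k$, only the latter condition is imposed. An access selection for $I$ maps every access on $I$ to a set of matching tuples; it is valid if every such set is a valid output. A monotone plan is a sequence of commands producing temporary tables: middleware commands $T:=E$ with $E$ a relational algebra expression without difference over previously produced tables, and access commands $T\Leftarrow \mathsf{mt}\Leftarrow E$ which evaluate $E$, use each resulting tuple (via an input mapping) as a binding for $\mathsf{mt}$, and store (via an output mapping) the union of the outputs of these accesses in $T$; the plan ends with $\mathsf{Return}\ T_0$. For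 a valid access selection $\sigma$, the plan has an output obtained by using $\sigma(\mathsf{mt},b)$ as the output of each access; the possible outputs on $I$ are the outputs for all valid $\sigma$. A monotone plan answers $Q$ under $\mathsf{Sch}$ if for every instance $I$ (finite or infinite) satisfying $\Sigma$ its only possible output is $Q(I)$; $Q$ is monotone answerable if such a plan exists. Accessible part: given an instance $I$ and a valid access selection $\sigma$, define $\mathrm{AccPart}_0=\emptyset$, $\mathrm{acc}_0=\emptyset$, $\mathrm{AccPart}_{i+1}=\bigcup \sigma(\mathsf{mt},b)$ over all methods $\mathsf{mt}$ and bindings $b$ with values in $\mathrm{acc}_i$ (viewed as sets of facts), $\mathrm{acc}_{i+1}$ = active domain of $\mathrm{AccPart}_{i+1}$; the accessible part is $\bigcup_i\mathrm{AccPart}_i$. $Q$ is access monotonically-determined (AMonDet) over $\mathsf{Sch}$ if for any instances $I_1,I_2$ satisfying $\Sigma$, if some accessible part of $I_1$ is a subset of some accessible part of $I_2$, then $Q(I_1)\subseteq Q(I_2)$. *)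

(* Defs.v *)
From mathcomp Require Import all_boot.
From mathcomp Require Import mathcomp_extra boolp classical_sets functions cardinality.

Set Implicit Arguments.
Unset Strict Implicit.
Unset Printing Implicit Defensive.

Local Open Scope classical_set_scope.
Local Open Scope card_scope.

(** * Signatures, facts, instances *)

Record signature := Signature {
  relname :> finType;
  arity : relname -> nat }.

Definition fact (S : signature) (D : Type) := {R : S & (arity R).-tuple D}.

Definition Fact (S : signature) (D : Type) (R : S) (t : (arity R).-tuple D)
  : fact S D := existT _ R t.

Definition fact_rel (S : signature) (D : Type) (f : fact S D) : S := projT1 f.

Definition fact_args (S : signature) (D : Type) (f : fact S D)
  : (arity (fact_rel f)).-tuple D := projT2 f.

(* [D] is an arbitrary ambient set of values: every notion below only depends
   on the values that occur in facts. *)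
Definition instance (S : signature) (D : Type) := set (fact S D).

Definition adom (S : signature) (D : Type) (I : instance S D) : set D :=
  [set d | exists (R : S) (t : (arity R).-tuple D) (i : 'I_(arity R)),
             I (Fact t) /\ tnth t i = d].

(** * First-order logic, active-domain semantics *)

(* [fo S n]: formulas with free variables indexed by ['I_n]. A quantifier binds
   the variable of index 0 of its body and shifts the others by one. *)
Inductive fo (S : signature) (n : nat) : Type :=
| FoRel (R : S) (xs : (arity R).-tuple 'I_n)
| FoEq (i j : 'I_n)
| FoTrue
| FoNot (phi : fo S n)
| FoAnd (phi psi : fo S n)
| FoOr (phi psi : fo S n)
| FoImp (phi psi : fo S n)
| FoEx (phi : fo S n.+1)
| FoAll (phi : fo S n.+1).

Fixpoint holds (S : signature) (D : Type) (I : instance S D) (n : nat)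
    (phi : fo S n) : n.-tuple D -> Prop :=
  match phi with
  | FoRel R xs => fun e => I (Fact (map_tuple (tnth e) xs))
  | FoEq i j => fun e => tnth e i = tnth e j
  | FoTrue => fun _ => True
  | FoNot p => fun e => ~ holds I p e
  | FoAnd p q => fun e => holds I p e /\ holds I q e
  | FoOr p q => fun e => holds I p e \/ holds I q e
  | FoImp p q => fun e => holds I p e -> holds I q e
  | FoEx p => fun e => exists d, adom I d /\ holds I p (cons_tuple d e)
  | FoAll p => fun e => forall d, adom I d -> holds I p (cons_tuple d e)
  end.

Definition sentence (S : signature) := fo S 0.

Definition models (S : signature) (D : Type) (I : instance S D)
    (Sigma : set (sentence S)) : Prop :=
  forall phi, Sigma phi -> holds I phi [tuple].

(** * Conjunctive queries *)

(* The formula [exists y_0 .. y_(m-1), A_1 /\ .. /\ A_p] with free variables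
   x_0 .. x_(n-1), where n = [cq_free] and m = [cq_bound]. An atom is a fact over
   the variables ['I_(n + m)]: x_i is [lshift m i] and y_j is [rshift n j].
   [cq_safe]: being free in the formula, each x_i occurs in some atom. *)
Record cq (S : signature) := CQ {
  cq_free : nat;
  cq_bound : nat;
  cq_atoms : seq (fact S 'I_(cq_free + cq_bound));
  cq_safe : forall i : 'I_cq_free,
    has (fun A => lshift cq_bound i \in fact_args A) cq_atoms }.

Fixpoint all_atoms (S : signature) (D : Type) (I : instance S D) (n : nat)
    (s : seq (fact S 'I_n)) (e : n.-tuple D) : Prop :=
  if s is A :: s' then
    I (Fact (map_tuple (tnth e) (fact_args A))) /\ all_atoms I s' e
  else True.

Definition answers (S : signature) (D : Type) (Q : cq S) (I : instance S D)
  : set ((cq_free Q).-tuple D) :=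
  [set x | exists y : (cq_bound Q).-tuple D,
             (forall j, adom I (tnth y j)) /\
             all_atoms I (cq_atoms Q) (cat_tuple x y)].

Arguments answers [S D] Q I _.

(** * Schemas with result-bounded access methods *)

Inductive result_bound : Type :=
| NoBound
| ResultBound (k : nat) of 0 < k
| ResultLowerBound (k : nat).

Record schema := Schema {
  sch_sig :> signature;
  constraints : set (sentence sch_sig);
  method : Type;
  method_rel : method -> sch_sig;
  method_inputs : forall mt : method, {set 'I_(arity (method_rel mt))};
  method_bound : method -> result_bound }.

Arguments constraints : clear implicits.

Definition method_arity (Sch : schema) (mt : method Sch) : nat :=
  arity (method_rel mt).

Definition input_pos (Sch : schema) (mt : method Sch) : finType :=
  {i : 'I_(method_arity mt) | i \in method_inputs mt}.

Definition binding (Sch : schema) (D : Type) (mt : method Sch) :=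
  {ffun input_pos mt -> D}.

Definition matching (Sch : schema) (D : Type) (I : instance Sch D)
    (mt : method Sch) (b : binding D mt) : set ((method_arity mt).-tuple D) :=
  [set t | I (Fact t) /\ forall i : input_pos mt, tnth t (val i) = b i].

Definition meets_lower (T : Type) (k : nat) (M J : set T) : Prop :=
  forall j : nat, j <= k -> `I_j #<= M -> `I_j #<= J.

Definition valid_output (T : Type) (B : result_bound) (M J : set T) : Prop :=
  J `<=` M /\
  match B with
  | NoBound => J = M
  | ResultBound k _ => J #<= `I_k /\ meets_lower k M J
  | ResultLowerBound k => meets_lower k M J
  end.

(* A selection is a total function of the binding; only its values on actual
   accesses, i.e. bindings into the active domain, are constrained. *)
Definition selection (Sch : schema) (D : Type) :=
  forall mt : method Sch, binding D mt -> set ((method_arity mt).-tuple D).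

Definition valid_selection (Sch : schema) (D : Type) (I : instance Sch D)
    (sigma : selection Sch D) : Prop :=
  forall (mt : method Sch) (b : binding D mt),
    (forall i, adom I (b i)) ->
    valid_output (method_bound mt) (matching I b) (sigma mt b).

(** * Monotone plans *)

(* A context [G : seq nat] lists the arities of the temporary tables produced so
   far, most recent first. *)
Inductive table : seq nat -> nat -> Type :=
| TableLast (n : nat) (G : seq nat) : table (n :: G) n
| TablePrev (n m : nat) (G : seq nat) : table G n -> table (m :: G) n.

(* Positional relational algebra without difference. [RaUnit] is the nullary
   table containing the empty tuple: it feeds methods without input positions.
   [RaEmpty] is the empty table. [RaProj f] returns the columns
   [f_0, f_1, ..] in this order, hence also covers renaming. *)
Inductive ra (G : seq nat) : nat -> Type :=
| RaTable n (T : table G n) : ra G n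
| RaUnit : ra G 0
| RaEmpty n : ra G n
| RaSelEq n (i j : 'I_n) (E : ra G n) : ra G n
| RaSelNeq n (i j : 'I_n) (E : ra G n) : ra G n
| RaProj n m (f : m.-tuple 'I_n) (E : ra G n) : ra G m
| RaProd n m (E : ra G n) (F : ra G m) : ra G (n + m)
| RaUnion n (E F : ra G n) : ra G n.

(* [Access mt E inmap outmap P] runs [T <= mt <= E] and continues with [P]:
   [inmap] gives the column of [E] feeding each input position, and [outmap] the
   position of the accessed relation stored in each column of [T]. *)
Inductive plan (Sch : schema) (n : nat) (G : seq nat) : Type :=
| Return (T : table G n)
| Middleware m (E : ra G m) (P : plan Sch n (m :: G))
| Access (mt : method Sch) m p (E : ra G m)
    (inmap : {ffun input_pos mt -> 'I_m})
    (outmap : p.-tuple 'I_(method_arity mt))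
    (P : plan Sch n (p :: G)).

Definition monotone_plan (Sch : schema) (n : nat) := plan Sch n [::].

Fixpoint tables (D : Type) (G : seq nat) : Type :=
  if G is n :: G' then (set (n.-tuple D) * tables D G')%type else unit.

Fixpoint lookup (D : Type) (G : seq nat) (n : nat) (T : table G n)
  : tables D G -> set (n.-tuple D) :=
  match T in table G n return tables D G -> set (n.-tuple D) with
  | TableLast _ _ => fun e => e.1
  | TablePrev _ _ _ T' => fun e => lookup T' e.2
  end.

Fixpoint ra_eval (D : Type) (G : seq nat) (e : tables D G) (n : nat)
    (E : ra G n) : set (n.-tuple D) :=
  match E in ra _ n return set (n.-tuple D) with
  | RaTable _ T => lookup T e
  | RaUnit => [set [tuple]]
  | RaEmpty _ => set0
  | RaSelEq _ i j E => [set t | ra_eval e E t /\ tnth t i = tnth t j]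
  | RaSelNeq _ i j E => [set t | ra_eval e E t /\ tnth t i <> tnth t j]
  | RaProj _ _ f E => [set map_tuple (tnth t) f | t in ra_eval e E]
  | RaProd _ _ E F =>
      [set cat_tuple t u | t in ra_eval e E & u in ra_eval e F]
  | RaUnion _ E F => ra_eval e E `|` ra_eval e F
  end.

Definition access_eval (Sch : schema) (D : Type) (sigma : selection Sch D)
    (mt : method Sch) (m p : nat) (T : set (m.-tuple D))
    (inmap : {ffun input_pos mt -> 'I_m})
    (outmap : p.-tuple 'I_(method_arity mt)) : set (p.-tuple D) :=
  [set map_tuple (tnth t) outmap
  | t in \bigcup_(u in T) sigma mt [ffun i => tnth u (inmap i)]].

Fixpoint plan_eval (Sch : schema) (D : Type) (sigma : selection Sch D)
    (n : nat) (G : seq nat) (P : plan Sch n G) : tables D G -> set (n.-tuple D) :=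
  match P with
  | Return T => fun e => lookup T e
  | Middleware _ E P => fun e => plan_eval sigma P (ra_eval e E, e)
  | Access mt _ _ E inmap outmap P => fun e =>
      plan_eval sigma P (access_eval sigma (ra_eval e E) inmap outmap, e)
  end.

Definition possible_outputs (Sch : schema) (D : Type) (n : nat)
    (P : monotone_plan Sch n) (I : instance Sch D) : set (set (n.-tuple D)) :=
  [set plan_eval sigma P tt | sigma in valid_selection I].

Definition plan_answers (Sch : schema) (Q : cq Sch)
    (P : monotone_plan Sch (cq_free Q)) : Prop :=
  forall (D : Type) (I : instance Sch D), models I (constraints Sch) ->
    possible_outputs P I = [set answers Q I].

Definition monotone_answerable (Sch : schema) (Q : cq Sch) : Prop :=
  exists P : monotone_plan Sch (cq_free Q), plan_answers P.

(** * Access monotonic-determinacy *)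

Fixpoint accpart_step (Sch : schema) (D : Type) (sigma : selection Sch D)
    (n : nat) : instance Sch D :=
  if n is n'.+1 then
    [set f | exists (mt : method Sch) (b : binding D mt),
               (forall i, adom (accpart_step sigma n') (b i)) /\
               exists2 t, sigma mt b t & f = Fact t]
  else set0.

Definition accpart (Sch : schema) (D : Type) (sigma : selection Sch D)
  : instance Sch D := \bigcup_n accpart_step sigma n.

Definition is_accessible_part (Sch : schema) (D : Type)
    (I A : instance Sch D) : Prop :=
  exists2 sigma : selection Sch D, valid_selection I sigma & A = accpart sigma.

Definition amondet (Sch : schema) (Q : cq Sch) : Prop :=
  forall (D : Type) (I1 I2 : instance Sch D),
    models I1 (constraints Sch) -> models I2 (constraints Sch) ->
    (exists A1 A2 : instance Sch D,
       [/\ is_accessible_part I1 A1, is_accessible_part I2 A2 & A1 `<=` A2]) ->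
    answers Q I1 `<=` answers Q I2.

(* Main.v *)
(* A plan is monotone, so its output can only grow when valid outputs over one
   instance are extended to valid outputs over another; this gives one direction.

   For the converse, any finite union of patterns (conjunctive queries with
   inequalities between all variables) over finitely many rounds of accesses is
   the output of a plan. If no union of sound patterns is complete, compactness
   yields an instance [I1], a subinstance [A] closed under the accesses on [I1],
   and an answer [c] on [I1] that no sound pattern finds in [A]. Then every finite
   part of [A] is an unsound pattern, that is, embeds injectively into a model on
   which [c] is not an answer, and compactness again yields one model [I2] that
   contains all of [A] and on which [c] is not an answer. Amalgamating [I1] and
   [I2] over [A] contradicts determinacy: since upper bounds do not prevent outputs
   from growing with the instance, [A] contains an accessible part of [I1] that is
   included in one of [I2]. Both uses of compactness are ultraproducts. *)

From mathcomp Require Import all_boot.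
From mathcomp Require Import mathcomp_extra boolp classical_sets functions.
From mathcomp Require Import cardinality filter.
Require Import Defs.

Set Implicit Arguments.
Unset Strict Implicit.
Unset Printing Implicit Defensive.

Local Open Scope classical_set_scope.
Local Open Scope card_scope.

(** * Valid outputs *)

Lemma card_ge_IP (T : Type) (k : nat) (A : set T) :
  `I_k #<= A <-> exists2 f : 'I_k -> T, injective f & forall i, A (f i).
Proof.
split=> [|[f f_inj fA]].
  rewrite (card_le_eql card_II) => /card_leP[f].
  exists (fun i => val (f (SigSub (in_setT i)))) => [i j /val_inj|i].
    by move=> /(@inj _ _ _ f _ _ (in_setT _) (in_setT _)) /(congr1 val).
  exact: set_mem (valP _).
have <- : (f @` setT #<= A) = (`I_k #<= A).
  apply: card_le_eql; rewrite (card_eqr card_II).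
  by apply: inj_card_eq => i j _ _; exact: f_inj.
by apply: subset_card_le => _ [i _ <-].
Qed.

Lemma card_uniq_seq (T : eqType) (s : seq T) :
  uniq s -> [set` s] #= `I_(size s).
Proof.
move=> s_uniq; rewrite (card_eqr card_II).
have -> : [set` s] = range (tnth (in_tuple s)).
  apply/seteqP; split=> [x /= /seq_tnthP[i ->]|_ [i _ <-] /=]; first by exists i.
  exact: mem_tnth.
by apply: inj_card_eq => i j _ _; exact: tuple_uniqP.
Qed.

(** [X] is listed first and then completed by the values outside [X] of an injection of ['I_k] into
    [M]; the first [k] entries form the desired set. *)
Lemma card_between (T : Type) (k : nat) (X M : set T) :
  X `<=` M -> X #<= `I_k -> `I_k #<= M ->
  exists J, [/\ X `<=` J, J `<=` M & J #= `I_k].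
Proof.
move=> XM Xk /card_ge_IP[f f_inj fM].
have /(@finite_seqP {classic T})[s0 X_s0] : finite_set X.
  by apply/finite_set_leP; exists k.
pose s := undup s0; have X_s : X = [set` s].
  by rewrite X_s0; apply/seteqP; split=> x /=; rewrite mem_undup.
have s_uniq : uniq s by exact: undup_uniq.
have s_le : size s <= k.
  by rewrite -card_le_II -(card_le_eql (card_uniq_seq s_uniq)) -X_s.
pose t : seq {classic T} := codom f.
pose u := s ++ [seq x <- t | x \notin s].
have u_uniq : uniq u.
  rewrite cat_uniq s_uniq filter_uniq ?andbT; last exact/injectiveP.
  by apply/hasPn => x; rewrite mem_filter => /andP[].
have u_M x : x \in u -> M x.
  rewrite mem_cat => /orP[xs|]; first by apply: XM; rewrite X_s.
  by rewrite mem_filter => /andP[_ /codomP[i ->]].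
have u_size : k <= size u.
  have <- : size t = k by rewrite size_codom card_ord.
  apply: uniq_leq_size; first exact/injectiveP.
  by move=> x xt; rewrite mem_cat mem_filter xt andbT orbN.
exists [set` take k u]; split.
- by move=> x; rewrite X_s /= take_cat ltnNge s_le /= mem_cat => ->.
- by move=> x /= /mem_take; exact: u_M.
- by have := card_uniq_seq (take_uniq k u_uniq); rewrite size_takel.
Qed.

(** Upper bounds do not obstruct growth: if [M] has at least [k] elements, the small set [X] is
    padded inside [M] to exactly [k]; otherwise [M] itself is small enough to be returned whole. [X]
    will be a valid output over another instance. *)
Lemma valid_output_extend (T : Type) (B : result_bound) (X M : set T) :
  X `<=` M -> (forall k k0, B = @ResultBound k k0 -> X #<= `I_k) ->
  exists2 J, X `<=` J & valid_output B M J.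
Proof.
move=> XM; case: B => [_|k k0 /(_ _ _ erefl) Xk|k _].
- by exists M => //; split.
- have [kM|/negP kM] := boolP (`I_k #<= M); last first.
    have Mk : M #<= `I_k.
      have [[n Mn]|/infiniteP inf] := pselect (finite_set M).
        rewrite (card_le_eql Mn) card_le_II ltnW // ltnNge.
        by rewrite -card_le_II -(card_le_eqr Mn); exact/negP.
      by case: kM; apply: card_le_trans inf; exact: card_leT.
    by exists M => //; split=> //; split.
  have [J [XJ JM Jk]] := card_between XM Xk kM.
  exists J => //; split=> //; split; first by rewrite (card_le_eql Jk).
  by move=> j jk _; rewrite (card_le_eqr Jk) card_le_II.
- by exists M => //; split.
Qed.

Lemma valid_output_exists (T : Type) (B : result_bound) (M : set T) :
  exists J, valid_output B M J.
Proof.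
by have [||J _ vJ] := @valid_output_extend _ B set0 M => //; exists J.
Qed.

Lemma valid_output_card (T : Type) (k : nat) (k0 : 0 < k) (M J : set T) :
  valid_output (ResultBound k0) M J -> J #<= `I_k.
Proof. by case=> _ []. Qed.

(* The part of [valid_output] that survives when [J] grows. *)
Definition sufficient_output (T : Type) (B : result_bound) (M J : set T) :=
  match B with
  | NoBound => M `<=` J
  | ResultBound k _ => meets_lower k M J
  | ResultLowerBound k => meets_lower k M J
  end.

(** A valid output for [N] as the set of matching tuples works: it respects the upper bound, and the
    lower bound passes from [M] to [N] and from [N] to the output. *)
Lemma sufficient_output_valid (T : Type) (B : result_bound) (M N : set T) :
  N `<=` M -> sufficient_output B M N ->
  exists2 J, J `<=` N & valid_output B M J.
Proof.
move=> NM suff.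
have [J [JN Jv]] := valid_output_exists B N.
exists J => //; split; first exact: subset_trans NM.
case: B suff Jv => /= [MN ->|k _ suff [Jk Jl]|k suff Jl].
- by apply/seteqP.
- by split=> // j jk jM; apply: Jl => //; apply: suff.
- by move=> j jk jM; apply: Jl => //; apply: suff.
Qed.

(** * Accessible parts *)

Lemma adomS (S : signature) (D : Type) (I J : instance S D) :
  I `<=` J -> adom I `<=` adom J.
Proof. by move=> IJ d [R [t [i [It <-]]]]; exists R, t, i; split=> //; exact: IJ. Qed.

Lemma adom_Fact (S : signature) (D : Type) (I : instance S D) (R : S)
    (t : (arity R).-tuple D) : I (Fact t) -> forall i, adom I (tnth t i).
Proof. by move=> It i; exists R, t, i. Qed.

Lemma Fact_inj (S : signature) (D : Type) (R : S) (t u : (arity R).-tuple D) :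
  Fact t = Fact u -> t = u.
Proof. exact: (@eq_from_Tagged S (fun R : S => (arity R).-tuple D)). Qed.

Lemma accpart_stepS (Sch : schema) (D : Type) (sigma : selection Sch D) m n :
  m <= n -> accpart_step sigma m `<=` accpart_step sigma n.
Proof.
elim: m n => [n _ f []|m IHm [//|n]]; rewrite ltnS => mn f /= [mt [b [mb tb]]].
by exists mt, b; split=> // i; apply: adomS (IHm _ mn) _ (mb i).
Qed.

(** Each value is witnessed by one fact, so finitely many values need finitely many members of the
    union. Applied to bindings, it turns accesses over a limit into accesses over one stage. *)
Lemma adom_directed (S : signature) (D : Type) (W : Type) (w0 : W)
    (A : W -> instance S D) (J : finType) (d : J -> D) :
  (forall v w, exists u, A v `<=` A u /\ A w `<=` A u) ->
  (forall j, adom (\bigcup_w A w) (d j)) ->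
  exists w, forall j, adom (A w) (d j).
Proof.
move=> dirA dA.
suff [w dw] : exists w, forall j, j \in enum J -> adom (A w) (d j).
  by exists w => j; apply: dw; rewrite mem_enum.
elim: (enum J) => [|j s [w dw]]; first by exists w0.
have [R [t [i [[v _ vt] ti]]]] := dA j.
have [u [vu wu]] := dirA v w; exists u => k; rewrite inE => /predU1P[->|/dw].
  by exists R, t, i; split=> //; exact: vu.
exact: adomS.
Qed.

Lemma accpart_closed (Sch : schema) (D : Type) (sigma : selection Sch D)
    (mt : method Sch) (b : binding D mt) t :
  (forall i, adom (accpart sigma) (b i)) -> sigma mt b t ->
  accpart sigma (Fact t).
Proof.
move=> ab bt.
have [|n nb] := adom_directed (A := accpart_step sigma) 0 _ ab.
  move=> m n; exists (maxn m n).
  by split; apply: accpart_stepS; rewrite ?leq_maxl ?leq_maxr.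
by exists n.+1 => //=; exists mt, b; split=> //; exists t.
Qed.

Lemma accpart_min (Sch : schema) (D : Type) (sigma : selection Sch D)
    (A : instance Sch D) :
  (forall mt (b : binding D mt) t, (forall i, adom A (b i)) -> sigma mt b t ->
     A (Fact t)) ->
  accpart sigma `<=` A.
Proof.
move=> cA f [n _]; elim: n f => [f []|n IHn f] /= [mt [b [nb [t bt ->]]]].
by apply: cA bt => i; exact: adomS IHn _ (nb i).
Qed.

Lemma accpart_sub (Sch : schema) (D : Type) (I : instance Sch D)
    (sigma : selection Sch D) :
  valid_selection I sigma -> accpart sigma `<=` I.
Proof.
move=> sv; apply: accpart_min => mt b t /sv[sM _] bt.
by have [] := sM _ bt.
Qed.

(** For a binding over the accessible part, the output of [sigma1] consists of accessible facts,
    hence of matching facts of [I2], and [valid_output_extend] enlarges it. *)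
Lemma valid_selection_extend (Sch : schema) (D : Type) (I1 I2 : instance Sch D)
    (sigma1 : selection Sch D) :
  valid_selection I1 sigma1 -> accpart sigma1 `<=` I2 ->
  exists2 sigma2 : selection Sch D, valid_selection I2 sigma2 &
    forall mt (b : binding D mt), (forall i, adom (accpart sigma1) (b i)) ->
      sigma1 mt b `<=` sigma2 mt b.
Proof.
move=> v1 a2.
have H mt (b : binding D mt) : exists J : set _,
    ((forall i, adom (accpart sigma1) (b i)) -> sigma1 mt b `<=` J) /\
    valid_output (method_bound mt) (matching I2 b) J.
  (* For other bindings any valid output on [I2] will do. *)
  have [ab|nab] := pselect (forall i, adom (accpart sigma1) (b i)); last first.
    by have [J vJ] := valid_output_exists (method_bound mt) (matching I2 b); exists J.
  have vb : valid_output (method_bound mt) (matching I1 b) (sigma1 mt b).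
    by apply: (v1) => i; exact: adomS (accpart_sub v1) _ (ab i).
  have [||J XJ vJ] := @valid_output_extend _ (method_bound mt) (sigma1 mt b)
    (matching I2 b).
  - move=> t bt; split; first exact/a2/(accpart_closed ab).
    by have [] := vb.1 _ bt.
  - by move=> k k0 E; move: vb; rewrite E; exact: valid_output_card.
  by exists J.
exists (fun mt b => projT1 (cid (H mt b))) => mt b ab.
  by case: cid => J /= [].
by case: cid => J /= [sJ _]; exact: sJ ab.
Qed.

Lemma valid_selection_exists (Sch : schema) (D : Type) (I : instance Sch D) :
  exists sigma : selection Sch D, valid_selection I sigma.
Proof.
exists (fun mt b => projT1 (cid (valid_output_exists (method_bound mt)
  (matching I b)))) => mt b _.
by case: cid.
Qed.

(** * Monotonicity of plans *)

(** Besides inclusion, [V] confines the values in the smaller tables, and so the bindings that a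
    plan can form from them. *)
Fixpoint tables_le (D : Type) (V : set D) (G : seq nat) :
    tables D G -> tables D G -> Prop :=
  if G is n :: G' then fun e1 e2 =>
    (forall t : n.-tuple D, e1.1 t -> e2.1 t /\ forall i, V (tnth t i)) /\
    tables_le V e1.2 e2.2
  else fun _ _ => True.

Lemma lookup_le (D : Type) (V : set D) (G : seq nat) n (T : table G n)
    (e1 e2 : tables D G) :
  tables_le V e1 e2 ->
  forall t, lookup T e1 t -> lookup T e2 t /\ forall i, V (tnth t i).
Proof. by elim: T e1 e2 => [m {}G|m k {}G T IHT] [? ?] [? ?] [] //= ? /IHT. Qed.

Lemma ra_eval_le (D : Type) (V : set D) (G : seq nat) n (E : ra G n)
    (e1 e2 : tables D G) :
  tables_le V e1 e2 ->
  forall t, ra_eval e1 E t -> ra_eval e2 E t /\ forall i, V (tnth t i).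
Proof.
move=> le12; elim: E => {n} /=.
- by move=> n T; exact: lookup_le.
- by move=> t ->; split=> // -[].
- by [].
- by move=> n i j E IH t [/IH[? ?]].
- by move=> n i j E IH t [/IH[? ?]].
- move=> n m f E IH _ [t /IH[t2 Vt] <-]; split; first by exists t.
  by move=> i; rewrite tnth_map.
- move=> n m E IHE F IHF _ [t /IHE[t2 Vt] [u /IHF[u2 Vu] <-]]; split.
    by exists t => //; exists u.
  by move=> i; case: (split_ordP i) => j ->; rewrite ?tnth_lshift ?tnth_rshift.
- by move=> n E IHE F IHF t [/IHE|/IHF] [? ?]; split=> //; [left|right].
Qed.

(** Without difference every operation is monotone. The selections are compared only on bindings
    over [V], which suffices because [sigma1] never leads out of [V]. *)
Lemma plan_eval_le (Sch : schema) (D : Type) (V : set D)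
    (sigma1 sigma2 : selection Sch D) (n : nat) (G : seq nat)
    (P : plan Sch n G) (e1 e2 : tables D G) :
  (forall mt (b : binding D mt), (forall i, V (b i)) ->
     forall t, sigma1 mt b t -> sigma2 mt b t /\ forall i, V (tnth t i)) ->
  tables_le V e1 e2 -> plan_eval sigma1 P e1 `<=` plan_eval sigma2 P e2.
Proof.
move=> le_sigma.
elim: P e1 e2 => {G} [G T|G m E P IHP|G mt m p E inmap outmap P IHP] e1 e2 le12 /=.
- by move=> t /(lookup_le le12)[].
- by apply: IHP; split=> //=; exact: ra_eval_le.
- apply: IHP; split=> //= _ [t [u /(ra_eval_le le12)[u2 Vu] ut] <-].
  have [|t2 Vt] := le_sigma _ _ _ _ ut; first by move=> i; rewrite ffunE.
  split; first by exists t => //; exists u.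
  by move=> i; rewrite tnth_map.
Qed.

Lemma answerable_amondet (Sch : schema) (Q : cq Sch) :
  monotone_answerable Q -> amondet Q.
Proof.
move=> [P PQ] D I1 I2 m1 m2 [_ [_ [[s1 v1 ->] [s2 v2 ->] a12]]].
have [s3 v3 s13] := valid_selection_extend v1 (subset_trans a12 (accpart_sub v2)).
have out I s : models I (constraints Sch) -> valid_selection I s ->
    plan_eval s P tt = answers Q I.
  move=> mI vs; have : possible_outputs P I (plan_eval s P tt) by exists s.
  by rewrite PQ.
rewrite -(out _ _ _ m1 v1) -(out _ _ _ m2 v3).
(* Starting from no tables, a plan run with [s1] only ever meets accessible values, which is exactly
   where [s3] is known to extend [s1]. *)
apply: (@plan_eval_le _ _ (adom (accpart s1))) => // mt b ab t bt.
split; first exact: s13 bt.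
exact: adom_Fact (accpart_closed ab bt).
Qed.

(** * Queries computed by plans *)

Definition output_query (Sch : schema) (n : nat) :=
  forall D : Type, selection Sch D -> set (n.-tuple D).

(** A plan always ends with [Return], so a prefix is not itself a plan. It is represented by its
    effect on continuations: whatever can be done from the tables [T] can be done from scratch. *)
Definition realized (Sch : schema) (G : seq nat)
    (T : forall D, selection Sch D -> tables D G) : Prop :=
  forall n (P : plan Sch n G), exists P0 : monotone_plan Sch n,
    forall D (sigma : selection Sch D),
      plan_eval sigma P0 tt = plan_eval sigma P (T D sigma).

Definition expressed (Sch : schema) (G : seq nat)
    (T : forall D, selection Sch D -> tables D G) (n : nat)
    (q : output_query Sch n) : Prop :=
  exists E : ra G n, forall D (sigma : selection Sch D),
    ra_eval (T D sigma) E = q D sigma.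

(* Any plan prefix can be prolonged so that [q] becomes definable from the
   tables, which makes computed queries composable. *)
Definition computed (Sch : schema) (n : nat) (q : output_query Sch n) : Prop :=
  forall G (T : forall D, selection Sch D -> tables D G), realized T ->
    exists G' (T' : forall D, selection Sch D -> tables D G'),
      [/\ realized T',
          forall m (p : output_query Sch m), expressed T p -> expressed T' p &
          expressed T' q].

Fixpoint ra_lift (m : nat) (G : seq nat) (n : nat) (E : ra G n)
  : ra (m :: G) n :=
  match E in ra _ n return ra (m :: G) n with
  | RaTable _ T => RaTable (TablePrev m T)
  | RaUnit => RaUnit _
  | RaEmpty n => RaEmpty _ n
  | RaSelEq _ i j E => RaSelEq i j (ra_lift m E)
  | RaSelNeq _ i j E => RaSelNeq i j (ra_lift m E)
  | RaProj _ _ f E => RaProj f (ra_lift m E)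
  | RaProd _ _ E F => RaProd (ra_lift m E) (ra_lift m F)
  | RaUnion _ E F => RaUnion (ra_lift m E) (ra_lift m F)
  end.

Lemma ra_eval_lift (D : Type) (m : nat) (G : seq nat) (n : nat) (E : ra G n)
    (X : set (m.-tuple D)) (e : tables D G) :
  ra_eval (G := m :: G) (X, e) (ra_lift m E) = ra_eval e E.
Proof.
elim: E => {n} //=.
- by move=> n i j E ->.
- by move=> n i j E ->.
- by move=> n k f E ->.
- by move=> n k E -> F ->.
- by move=> n E -> F ->.
Qed.

(** * Closure properties of computed queries *)

Section Computed.
Variable Sch : schema.

Lemma computed_plan n (q : output_query Sch n) :
  computed q -> exists P : monotone_plan Sch n,
    forall D (sigma : selection Sch D), plan_eval sigma P tt = q D sigma.
Proof.
move=> /(_ [::] (fun _ _ => tt))[|G [T [rT _ [E qE]]]].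
  by move=> m P; exists P.
have [P0 P0E] := rT _ (Middleware E (Return Sch (TableLast n G))).
by exists P0 => D s; rewrite P0E /= qE.
Qed.

Lemma computed_expr0 n (q : output_query Sch n) :
  (forall G (T : forall D, selection Sch D -> tables D G), expressed T q) ->
  computed q.
Proof. by move=> qE G T rT; exists G, T. Qed.

Lemma computed_expr1 n m (p : output_query Sch n) (q : output_query Sch m) :
  (forall G (T : forall D, selection Sch D -> tables D G),
     expressed T p -> expressed T q) ->
  computed p -> computed q.
Proof.
move=> pq cp G T /cp[G' [T' [rT' lT' eT']]].
by exists G', T'; split=> //; exact: pq.
Qed.

Lemma computed_expr2 n n' m (p : output_query Sch n) (p' : output_query Sch n')
    (q : output_query Sch m) :
  (forall G (T : forall D, selection Sch D -> tables D G),
     expressed T p -> expressed T p' -> expressed T q) ->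
  computed p -> computed p' -> computed q.
Proof.
move=> pq cp cp' G T /cp[G1 [T1 [rT1 lT1 eT1]]].
have [G2 [T2 [rT2 lT2 eT2]]] := cp' _ _ rT1.
(* The second prolongation starts from the tables of the first and keeps [p] expressible. *)
exists G2, T2; split=> // [k r /lT1/lT2//|].
by apply: pq => //; exact: lT2.
Qed.

Lemma computed_ext n (q q' : output_query Sch n) :
  (forall D (sigma : selection Sch D) t, q D sigma t <-> q' D sigma t) ->
  computed q -> computed q'.
Proof.
move=> qq'; apply: computed_expr1 => G T [E qE]; exists E => D s.
by rewrite qE; apply/seteqP; split=> t /qq'.
Qed.

Lemma computed_empty n : computed (fun D (_ : selection Sch D) => @set0 (n.-tuple D)).
Proof. by apply: computed_expr0 => G T; exists (RaEmpty _ n). Qed.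

Lemma computed_unit : computed (fun D (_ : selection Sch D) => [set: 0.-tuple D]).
Proof.
apply: computed_expr0 => G T; exists (RaUnit _) => D s /=.
by apply/seteqP; split=> // t _; exact: tuple0.
Qed.

Lemma computed_union n (p q : output_query Sch n) :
  computed p -> computed q -> computed (fun D s => p D s `|` q D s).
Proof.
apply: computed_expr2 => G T [E pE] [F qF].
by exists (RaUnion E F) => D s /=; rewrite pE qF.
Qed.

Lemma computed_prod n m (p : output_query Sch n) (q : output_query Sch m) :
  computed p -> computed q ->
  computed (fun D s => [set cat_tuple t u | t in p D s & u in q D s]).
Proof.
apply: computed_expr2 => G T [E pE] [F qF].
by exists (RaProd E F) => D s /=; rewrite pE qF.
Qed.

Lemma computed_proj n m (f : m.-tuple 'I_n) (q : output_query Sch n) :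
  computed q ->
  computed (fun D s => [set map_tuple (tnth t) f | t in q D s]).
Proof.
apply: computed_expr1 => G T [E qE].
by exists (RaProj f E) => D s /=; rewrite qE.
Qed.

Lemma computed_access mt m (q : output_query Sch m)
    (inmap : {ffun input_pos mt -> 'I_m}) :
  computed q ->
  computed (fun D s => \bigcup_(u in q D s) s mt [ffun i => tnth u (inmap i)]).
Proof.
move=> cq G T /cq[G1 [T1 [rT1 lT1 [E qE]]]].
(* The identity output mapping stores whole tuples, in a table added after the prefix for [q]. *)
pose outmap := ord_tuple (method_arity mt).
exists (method_arity mt :: G1),
  (fun D s => (access_eval s (q D s) inmap outmap, T1 D s)); split.
- move=> k P; have [P0 P0E] := rT1 _ (Access E inmap outmap P).
  by exists P0 => D s; rewrite P0E /= qE.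
- move=> k r /lT1[F rF]; exists (ra_lift _ F) => D s.
  by rewrite ra_eval_lift rF.
- exists (RaTable (TableLast _ _)) => D s /=.
  have idE (t : (method_arity mt).-tuple D) : map_tuple (tnth t) outmap = t.
    by apply: eq_from_tnth => i; rewrite tnth_map tnth_ord_tuple.
  apply/seteqP; split=> [_ [t qt <-]|t qt]; first by rewrite idE.
  by exists t.
Qed.

Lemma computed_bigcup (I : finType) n (q : I -> output_query Sch n) :
  (forall i, computed (q i)) -> computed (fun D s => \bigcup_i q i D s).
Proof.
move=> cq.
suff : computed (fun D s => \bigcup_(i in [set` enum I]) q i D s).
  apply: computed_ext => D s t; split=> -[i _ it]; exists i => //=.
  by rewrite mem_enum.
elim: (enum I) => [|i r IHr].
  by apply: computed_ext (computed_empty n) => D s t; split=> // -[].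
apply: computed_ext (computed_union (cq i) IHr) => D s t; split.
  case=> [it|[j jr jt]]; first by exists i => //=; rewrite mem_head.
  by exists j => //=; rewrite inE jr orbT.
by move=> [j]; rewrite /= inE => /predU1P[->|jr] jt; [left|right; exists j].
Qed.

Lemma computed_filter (I : finType) n (q : output_query Sch n)
    (P : I -> forall D, n.-tuple D -> Prop) :
  (forall i (p : output_query Sch n), computed p ->
     computed (fun D s => [set t | p D s t /\ P i D t])) ->
  computed q -> computed (fun D s => [set t | q D s t /\ forall i, P i D t]).
Proof.
move=> cP cq.
suff : computed (fun D s => [set t | q D s t /\ forall i, i \in enum I -> P i D t]).
  apply: computed_ext => D s t; split=> -[qt Pt]; split=> // i.
  by apply: Pt; rewrite mem_enum.
elim: (enum I) => [|i r IHr].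
  by apply: computed_ext cq => D s t; split=> [|[]].
apply: computed_ext (cP i _ IHr) => D s t /=; split.
  by move=> [[qt rt] it]; split=> // j; rewrite inE => /predU1P[->|/rt].
move=> [qt rt]; split; last by apply: rt; rewrite mem_head.
by split=> // j jr; apply: rt; rewrite inE jr orbT.
Qed.

Lemma computed_eqs (I : finType) n (f g : I -> 'I_n) (q : output_query Sch n) :
  computed q ->
  computed (fun D s => [set t | q D s t /\ forall i, tnth t (f i) = tnth t (g i)]).
Proof.
apply: computed_filter => i p; apply: computed_expr1 => G T [E pE].
by exists (RaSelEq (f i) (g i) E) => D s /=; rewrite pE.
Qed.

Lemma computed_uniq n (q : output_query Sch n) :
  computed q ->
  computed (fun D s => [set t | q D s t /\ injective (tnth t)]).
Proof.
pose I := {ij : 'I_n * 'I_n | ij.1 != ij.2}.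
move=> cq; have : computed (fun D s => [set t | q D s t /\
    forall i : I, tnth t (val i).1 <> tnth t (val i).2]).
  apply: computed_filter cq => i p; apply: computed_expr1 => G T [E pE].
  by exists (RaSelNeq (val i).1 (val i).2 E) => D s /=; rewrite pE.
apply: computed_ext => D s t; split=> -[qt It]; split=> //.
  move=> i j tij; apply/eqP/negPn/negP => ij.
  exact: (It (exist _ (i, j) ij)).
by move=> [[i j] /= ij] /It/eqP; exact/negP.
Qed.

Lemma computed_power (q : output_query Sch 1) k :
  computed q ->
  computed (fun D s => [set t : k.-tuple D | forall i, q D s [tuple tnth t i]]).
Proof.
move=> cq; elim: k => [|k IHk].
  by apply: computed_ext computed_unit => D s t; split=> // _ [].
apply: computed_ext (computed_prod cq IHk) => D s t; split.
  move=> [u qu [v qv <-]] i; case: (@split_ordP 1 k i) => j ->.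
    have -> : [tuple tnth (cat_tuple u v) (lshift k j)] = u; last by [].
    by apply: eq_from_tnth => l; rewrite !ord1; exact: tnth_lshift.
  have -> : tnth (cat_tuple u v) (rshift 1 j) = tnth v j by exact: tnth_rshift.
  exact: qv.
move=> qt; exists [tuple tnth t ord0]; first exact: qt.
exists (behead_tuple t) => [i|]; first by rewrite tnth_behead; exact: qt.
by apply: val_inj => /=; case/tupleP: t qt.
Qed.

End Computed.

(** * Patterns in the layers of the accessible part *)

(** A round of [accpart_step] uses all methods, of which there may be infinitely many; a plan can
    only run finitely many. Here each round uses one method, the last of the list first, and earlier
    facts are kept. *)
Fixpoint layer (Sch : schema) (D : Type) (sigma : selection Sch D)
    (w : seq (method Sch)) : instance Sch D :=
  if w is mt :: w' then
    layer sigma w' `|`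
    [set f | exists b : binding D mt, (forall i, adom (layer sigma w') (b i)) /\
               exists2 t, sigma mt b t & f = Fact t]
  else set0.

Lemma layer_suffix (Sch : schema) (D : Type) (sigma : selection Sch D) u v :
  layer sigma v `<=` layer sigma (u ++ v).
Proof. by elim: u => //= mt u IHu f /IHu; left. Qed.

(** In [u ++ v] the rounds of [u] start from the layer of [v] instead of the empty instance.
    Together with [layer_suffix] this makes the layers directed. *)
Lemma layer_prefix (Sch : schema) (D : Type) (sigma : selection Sch D) u v :
  layer sigma u `<=` layer sigma (u ++ v).
Proof.
elim: u => [f []|mt u IHu f /= [/IHu|[b [ub bt]]]]; first by left.
by right; exists b; split=> // i; exact: adomS IHu _ (ub i).
Qed.

Lemma layer_sub (Sch : schema) (D : Type) (I : instance Sch D)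
    (sigma : selection Sch D) w :
  valid_selection I sigma -> layer sigma w `<=` I.
Proof.
move=> vs; elim: w => [f []|mt w IHw f /= [/IHw//|[b [wb [t bt ->]]]]].
have [|sM _] := vs mt b; first by move=> i; exact: adomS IHw _ (wb i).
by have [] := sM _ bt.
Qed.

Record pattern (Sch : schema) (n : nat) := Pattern {
  pat_methods : seq (method Sch);
  pat_vars : nat;
  pat_atoms : seq (fact Sch 'I_pat_vars);
  pat_head : n.-tuple 'I_pat_vars }.

(* Distinct variables take distinct values: a pattern describes a finite
   instance up to isomorphism, not up to homomorphism. *)
Definition pattern_answers (Sch : schema) (n : nat) (p : pattern Sch n)
    (D : Type) (sigma : selection Sch D) : set (n.-tuple D) :=
  [set map_tuple (tnth e) (pat_head p) | e in
    [set e : (pat_vars p).-tuple D |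
      [/\ forall i, adom (layer sigma (pat_methods p)) (tnth e i),
          injective (tnth e) &
          all_atoms (layer sigma (pat_methods p)) (pat_atoms p) e]]].

(** * Patterns are computed by plans *)

Section ComputedPatterns.
Variable Sch : schema.

(** The active domain is a union of projections, one for each relation and position; it is finite
    because the signature is. *)
Lemma computed_layer_adom w :
  (forall R : Sch, computed (fun D (sigma : selection Sch D) =>
    [set t : (arity R).-tuple D | layer sigma w (Fact t)])) ->
  computed (fun D (sigma : selection Sch D) =>
    [set t : 1.-tuple D | adom (layer sigma w) (tnth t ord0)]).
Proof.
move=> cw; have := computed_bigcup (fun R => computed_bigcup (fun i =>
  computed_proj [tuple i] (cw R))).
apply: computed_ext => D s t; split.
  by move=> [R _ [i _ [u uw <-]]]; exists R, u, i.
move=> [R [u [i [uw ui]]]]; exists R => //; exists i => //; exists u => //.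
by apply: eq_from_tnth => j; rewrite ord1.
Qed.

Lemma computed_layer w (R : Sch) :
  computed (fun D (sigma : selection Sch D) =>
    [set t : (arity R).-tuple D | layer sigma w (Fact t)]).
Proof.
elim: w R => [|mt w IHw] R.
  by apply: computed_ext (computed_empty _) => D s t.
have [->|RN] := eqVneq R (method_rel mt); last first.
  apply: computed_ext (IHw R) => D s t; split=> [|[//|[b [_ [u _ E]]]]].
    by left.
  by case/eqP: RN; have := congr1 (@fact_rel Sch D) E.
(* This table holds all bindings of [mt] over the previous layer, with the input positions numbered
   by [enum_rank]. *)
have cb := computed_power #|input_pos mt| (computed_layer_adom IHw).
have := computed_union (IHw (method_rel mt))
  (computed_access (finfun (@enum_rank (input_pos mt))) cb).
apply: computed_ext => D s t; split.
  case=> [wt|[u wu ut]]; first by left.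
  right; exists [ffun i => tnth u (finfun (@enum_rank (input_pos mt)) i)].
  by split=> [i|]; [rewrite ffunE; exact: wu|exists t].
case=> [wt|[b [wb [u bu /Fact_inj tu]]]]; first by left.
rewrite {}tu; right; exists [tuple b (enum_val i) | i < #|input_pos mt|] => [i|].
  by rewrite /= [tnth _ ord0]tnth_mktuple; exact: wb.
suff -> : [ffun i => tnth [tuple b (enum_val i) | i < #|input_pos mt|]
    (finfun (@enum_rank (input_pos mt)) i)] = b by [].
by apply/ffunP => i; rewrite !ffunE tnth_mktuple enum_rankK.
Qed.

(** An atom is imposed by a join: product with the table of its relation, equality of each argument
    with its variable, and projection back to the variables. *)
Lemma computed_atom w m (A : fact Sch 'I_m) (q : output_query Sch m) :
  computed q ->
  computed (fun D s => [set e | q D s e /\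
    layer s w (Fact (map_tuple (tnth e) (fact_args A)))]).
Proof.
move=> cq; have cA := computed_layer w (fact_rel A).
have := computed_proj [tuple lshift (arity (fact_rel A)) i | i < m]
  (computed_eqs (fun i => lshift _ (tnth (fact_args A) i)) (@rshift m _)
     (computed_prod cq cA)).
apply: computed_ext => D s e; split.
  move=> [_ [[f qf [t wt <-]] /= ft] <-].
  have -> : map_tuple (tnth (cat_tuple f t))
      [tuple lshift (arity (fact_rel A)) i | i < m] = f.
    by apply: eq_from_tnth => i; rewrite tnth_map tnth_mktuple tnth_lshift.
  split=> //; congr (layer _ _ (Fact _)): wt.
  apply: eq_from_tnth => i; rewrite tnth_map.
  by have := ft i; rewrite tnth_lshift tnth_rshift.
move=> [qe we]; exists (cat_tuple e (map_tuple (tnth e) (fact_args A))).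
  split; first by exists e => //; eexists; first exact: we.
  by move=> i; rewrite tnth_lshift tnth_rshift tnth_map.
by apply: eq_from_tnth => i; rewrite tnth_map tnth_mktuple tnth_lshift.
Qed.

Lemma computed_all_atoms w m (s : seq (fact Sch 'I_m)) (q : output_query Sch m) :
  computed q ->
  computed (fun D sigma => [set e | q D sigma e /\
    all_atoms (layer sigma w) s e]).
Proof.
elim: s q => [|A s IHs] q cq; first by apply: computed_ext cq => D sg e; split=> [|[]].
apply: computed_ext (IHs _ (computed_atom w A cq)) => D sg e /=.
by split=> [[[]]|[? []]].
Qed.

Lemma computed_pattern n (p : pattern Sch n) : computed (pattern_answers p).
Proof.
have := computed_proj (pat_head p) (computed_all_atoms (pat_methods p) (pat_atoms p)
  (computed_uniq (computed_power (pat_vars p)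
    (computed_layer_adom (computed_layer (pat_methods p)))))).
apply: computed_ext => D s t; split.
  by move=> [e [[]]] ? ? ? <-; exists e.
by move=> [e []] ? ? ? <-; exists e.
Qed.

Lemma computed_patterns (T : eqType) n (p : T -> pattern Sch n) (l : seq T) :
  computed (fun D s => \bigcup_(k in [set` l]) pattern_answers (p k) s).
Proof.
elim: l => [|k l IHl].
  by apply: computed_ext (computed_empty _) => D s t; split=> // -[].
apply: computed_ext (computed_union (computed_pattern (p k)) IHl) => D s t; split.
  case=> [kt|[j jl jt]]; first by exists k => //=; rewrite mem_head.
  by exists j => //=; rewrite inE jl orbT.
by move=> [j]; rewrite /= inE => /predU1P[->|jl] jt; [left|right; exists j].
Qed.

End ComputedPatterns.

(** * Amalgamation along a partial injection *)

Lemma tuple_choice (T : Type) (n : nat) (P : 'I_n -> T -> Prop) :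
  (forall i, exists x, P i x) -> exists t : n.-tuple T, forall i, P i (tnth t i).
Proof.
by move=> /choice[f Pf]; exists [tuple f i | i < n] => i; rewrite tnth_mktuple.
Qed.

Lemma map_tuple_inj (T U : Type) (f : T -> U) n :
  injective f -> injective (map_tuple f : n.-tuple T -> n.-tuple U).
Proof.
move=> f_inj t u tu; apply: eq_from_tnth => i; apply: f_inj.
by have := congr1 (fun v => tnth v i) tu; rewrite !tnth_map.
Qed.

Lemma map_tuple_tnth (T U : Type) (f : T -> U) n m (e : n.-tuple T)
    (xs : m.-tuple 'I_n) :
  map_tuple (tnth (map_tuple f e)) xs = map_tuple f (map_tuple (tnth e) xs).
Proof. by apply: eq_from_tnth => i; rewrite !tnth_map. Qed.

(** * Invariance under injective renaming of values *)

Section Image.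
Variables (S : signature) (D E : Type) (f : D -> E).
Hypothesis f_inj : injective f.

Definition image_instance (I : instance S D) : instance S E :=
  [set Fact (map_tuple f (fact_args A)) | A in I].

Lemma image_instanceP I (R : S) (u : (arity R).-tuple E) :
  image_instance I (Fact u) <-> exists2 t, I (Fact t) & map_tuple f t = u.
Proof.
split=> [[[R' t] /= It E0]|[t It <-]]; last by exists (Fact t).
have RR : R' = R := congr1 (@fact_rel S E) E0.
by case: _ / RR u E0 => u /Fact_inj <-; exists t.
Qed.

Lemma image_instance_map I (R : S) (t : (arity R).-tuple D) :
  image_instance I (Fact (map_tuple f t)) <-> I (Fact t).
Proof.
rewrite image_instanceP; split=> [[u Iu /(map_tuple_inj f_inj) <-]//|It].
by exists t.
Qed.

Lemma adom_image I d : adom (image_instance I) d <-> exists2 c, adom I c & f c = d.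
Proof.
split=> [[R [_ [i [/image_instanceP[t It <-] <-]]]]|].
  by exists (tnth t i); [exact: adom_Fact|rewrite tnth_map].
move=> [_ [R [t [i [It <-]]]] <-]; exists R, (map_tuple f t), i.
by rewrite tnth_map; split=> //; apply/image_instance_map.
Qed.

(** Active-domain quantifiers see only values of the form [f d], so values outside the range of [f]
    have no influence. *)
Lemma holds_image I n (phi : fo S n) (e : n.-tuple D) :
  holds (image_instance I) phi (map_tuple f e) <-> holds I phi e.
Proof.
have consE m d (x : m.-tuple D) :
    cons_tuple (f d) (map_tuple f x) = map_tuple f (cons_tuple d x).
  exact: val_inj.
elim: phi e => {n} /=.
- by move=> n R xs e; rewrite map_tuple_tnth image_instance_map.
- by move=> n i j e; rewrite !tnth_map; split=> [/f_inj|->].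
- by [].
- by move=> n p IH e; rewrite IH.
- by move=> n p IHp q IHq e; rewrite IHp IHq.
- by move=> n p IHp q IHq e; rewrite IHp IHq.
- by move=> n p IHp q IHq e; rewrite IHp IHq.
- move=> n p IH e; split=> [[_ [/adom_image[d Id <-] pd]]|[d [Id pd]]].
    by exists d; split=> //; apply/IH; rewrite -consE.
  by exists (f d); split; [apply/adom_image; exists d|rewrite consE IH].
- move=> n p IH e; split=> [pI d Id|pI _ /adom_image[d Id <-]].
    by apply/IH; rewrite -consE; apply: pI; apply/adom_image; exists d.
  by rewrite consE IH; exact: pI.
Qed.

Lemma models_image I Sigma : models I Sigma -> models (image_instance I) Sigma.
Proof.
move=> mI phi /mI /holds_image.
by have -> : map_tuple f [tuple] = [tuple] by exact: tuple0.
Qed.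

Lemma all_atoms_image I n (s : seq (fact S 'I_n)) (e : n.-tuple D) :
  all_atoms (image_instance I) s (map_tuple f e) <-> all_atoms I s e.
Proof.
by elim: s => //= A s <-; rewrite map_tuple_tnth image_instance_map.
Qed.

Lemma answers_image (Q : cq S) I (c : (cq_free Q).-tuple D) :
  answers Q (image_instance I) (map_tuple f c) <-> answers Q I c.
Proof.
have catE m n (x : m.-tuple D) (y : n.-tuple D) :
    cat_tuple (map_tuple f x) (map_tuple f y) = map_tuple f (cat_tuple x y).
  by apply: val_inj; rewrite /= map_cat.
split=> [[y' [Iy' ay']]|[y [Iy ay]]].
  have [j|y Hy] := @tuple_choice _ _ (fun j x => adom I x /\ f x = tnth y' j).
    by have /adom_image[x] := Iy' j; exists x.
  have y'E : y' = map_tuple f y by apply: eq_from_tnth => j; rewrite tnth_map (Hy j).2.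
  exists y; split=> [j|]; first exact: (Hy j).1.
  by apply/all_atoms_image; rewrite -catE -y'E.
exists (map_tuple f y); split; last by rewrite catE all_atoms_image.
by move=> j; apply/adom_image; exists (tnth y j); rewrite ?tnth_map.
Qed.

End Image.

Lemma answers_adom (S : signature) (D : Type) (Q : cq S) (I : instance S D) x :
  answers Q I x -> forall i, adom I (tnth x i).
Proof.
move=> [y [_ xy]] i; move: (cq_safe i); rewrite -(tnth_lshift x y).
elim: (cq_atoms Q) xy => //= A s IHs [IA /IHs as_] /orP[/tnthP[j jE]|//].
exists (fact_rel A), (map_tuple (tnth (cat_tuple x y)) (fact_args A)), j.
by split=> //; rewrite tnth_map jE.
Qed.

(** Such an [A] with [A] included in [I] contains an accessible part of [I], but it may exceed the
    upper bounds and need not be one. *)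
Definition access_closed (Sch : schema) (D : Type) (I A : instance Sch D) :=
  forall mt (b : binding D mt), (forall i, adom A (b i)) ->
    sufficient_output (method_bound mt) (matching I b) (matching A b).

(** A valid selection on [I1] is chosen with outputs inside [A] for bindings over [A]. Its
    accessible part lies in [A], hence in [I2], so the selection extends to [I2] and the accessible
    parts are nested. *)
Lemma amondet_closed (Sch : schema) (Q : cq Sch) (D : Type)
    (I1 I2 A : instance Sch D) :
  amondet Q -> models I1 (constraints Sch) -> models I2 (constraints Sch) ->
  A `<=` I1 -> access_closed I1 A -> A `<=` I2 ->
  answers Q I1 `<=` answers Q I2.
Proof.
move=> mdQ m1 m2 A1 cA A2.
have H mt (b : binding D mt) : exists J : set _,
    ((forall i, adom A (b i)) -> J `<=` matching A b) /\
    valid_output (method_bound mt) (matching I1 b) J.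
  have [Ab|nAb] := pselect (forall i, adom A (b i)); last first.
    by have [J vJ] := valid_output_exists (method_bound mt) (matching I1 b); exists J.
  have [|J JA vJ] := sufficient_output_valid _ (cA mt b Ab).
    by move=> t [At bt]; split=> //; exact: A1.
  by exists J.
pose s1 mt (b : binding D mt) := projT1 (cid (H mt b)).
have v1 : valid_selection I1 s1.
  by move=> mt b _; rewrite /s1; case: cid => J /= [].
have aA : accpart s1 `<=` A.
  apply: accpart_min => mt b t Ab; rewrite /s1; case: cid => J /= [JA _] Jt.
  by have [] := JA Ab _ Jt.
have [s2 v2 s12] := valid_selection_extend v1 (subset_trans aA A2).
apply: mdQ => //; exists (accpart s1), (accpart s2); split.
- by exists s1.
- by exists s2.
(* The intersection carries the induction: [s2] extends [s1] only on bindings over [accpart s1]. *)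
suff : accpart s1 `<=` accpart s1 `&` accpart s2 by move=> a12 f /a12[].
apply: accpart_min => mt b t ab bt.
have ab1 i : adom (accpart s1) (b i) by apply: adomS (ab i) => f [].
have ab2 i : adom (accpart s2) (b i) by apply: adomS (ab i) => f [].
split; first exact: accpart_closed bt.
by apply: (accpart_closed ab2); exact: s12 bt.
Qed.

Lemma sufficient_output_image (T U : Type) (g : T -> U) B (M N : set T) :
  injective g -> sufficient_output B M N ->
  sufficient_output B (g @` M) (g @` N).
Proof.
move=> g_inj.
have gE (X : set T) : g @` X #= X by apply: inj_card_eq => x y _ _; exact: g_inj.
case: B => /= [MN|k _ MN|k MN]; first exact: image_subset.
- by move=> j jk; rewrite (card_le_eqr (gE M)) (card_le_eqr (gE N)); exact: MN.
- by move=> j jk; rewrite (card_le_eqr (gE M)) (card_le_eqr (gE N)); exact: MN.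
Qed.

Lemma access_closed_image (Sch : schema) (D E : Type) (f : D -> E)
    (I A : instance Sch D) :
  injective f -> access_closed I A ->
  access_closed (image_instance f I) (image_instance f A).
Proof.
move=> f_inj cA mt b' Ab'.
have /choice[b0 Hb] : forall i, exists c, adom A c /\ f c = b' i.
  by move=> i; have /(adom_image f_inj)[c Ac <-] := Ab' i; exists c.
pose b : binding D mt := finfun b0.
have mE (J : instance Sch D) :
    matching (image_instance f J) b' = map_tuple f @` matching J b.
  apply/seteqP; split=> [_ [/image_instanceP[t Jt <-] tb]|_ [t [Jt tb] <-]].
    exists t => //; split=> // i; apply: f_inj.
    by rewrite -tnth_map tb ffunE (Hb i).2.
  split=> [|i]; first by apply/image_instance_map.
  by rewrite tnth_map tb ffunE (Hb i).2.
rewrite !mE; apply: sufficient_output_image; first exact: map_tuple_inj.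
by apply: cA => i; rewrite ffunE; exact: (Hb i).1.
Qed.

(** The relation [r] is a partial injection embedding [A] into [I2]. Gluing [D1] and [D2] along it
    gives copies of [I1] and [I2] over one set of values, both containing the copy of [A], to which
    [amondet_closed] applies. *)
Lemma amondet_amalgam (Sch : schema) (Q : cq Sch) (D1 D2 : Type)
    (I1 A : instance Sch D1) (I2 : instance Sch D2) (r : D1 -> D2 -> Prop) :
  amondet Q -> models I1 (constraints Sch) -> models I2 (constraints Sch) ->
  A `<=` I1 -> access_closed I1 A ->
  (forall x y y', r x y -> r x y' -> y = y') ->
  (forall x x' y, r x y -> r x' y -> x = x') ->
  (forall (R : Sch) (t : (arity R).-tuple D1), A (Fact t) ->
     exists u, (forall i, r (tnth t i) (tnth u i)) /\ I2 (Fact u)) ->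
  forall c, answers Q I1 c ->
    exists u, (forall i, r (tnth c i) (tnth u i)) /\ answers Q I2 u.
Proof.
move=> mdQ m1 m2 A1 cA rfun rinj rA c c1.
(* A value related to some [x] is identified with [x]; the others stay apart from [D1]. *)
pose j2 y : D1 + D2 :=
  if pselect (exists x, r x y) is left h then inl (projT1 (cid h)) else inr y.
have j2P x y : j2 y = inl x -> r x y.
  by rewrite /j2; case: pselect => // h [<-]; case: cid.
have j2E x y : r x y -> j2 y = inl x.
  move=> xy; rewrite /j2; case: pselect => [h|[]]; last by exists x.
  by congr inl; case: cid => x' /= x'y; exact: rinj x'y xy.
have j2_inj : injective j2.
  move=> y y'; case E : (j2 y) => [x|z] /esym.
    by move=> /j2P; apply: rfun; exact: j2P E.
  move: E; rewrite /j2; case: pselect => // _ [<-].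
  by case: pselect => // _ [].
have inl_inj : injective (@inl D1 D2) by move=> x y [].
have : answers Q (image_instance j2 I2) (map_tuple inl c).
  apply: (@amondet_closed _ _ _ (image_instance inl I1) _ (image_instance inl A)) => //.
  - exact: models_image.
  - exact: models_image.
  - exact: image_subset.
  - exact: access_closed_image.
  - move=> _ [[R t] At <-] /=; have [u [tu Iu]] := rA R t At.
    apply/image_instanceP; exists u => //.
    by apply: eq_from_tnth => i; rewrite !tnth_map; exact: j2E.
  - exact/(answers_image inl_inj).
(* Entries of an answer are active by safety of the query, so each entry of [c] is a glued value and
   has a partner in [D2]. *)
move=> c2; have [u cu] : exists u : (cq_free Q).-tuple D2,
    forall i, r (tnth c i) (tnth u i).
  apply: (tuple_choice (P := fun i => r (tnth c i))) => i.
  have := answers_adom c2 i; rewrite tnth_map.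
  by move=> /(adom_image j2_inj)[y _ /j2P]; exists y.
exists u; split=> //; apply/(answers_image j2_inj).
have <- // : map_tuple inl c = map_tuple j2 u.
by apply: eq_from_tnth => i; rewrite !tnth_map; apply/esym/j2E.
Qed.

(** * Ultraproducts *)

(** The index set for compactness: a list stands for finitely many requirements, and each single
    requirement is imposed at almost all indices. The cones above lists have the finite intersection
    property by concatenation. *)
Lemma ultrafilter_cones (T : eqType) : exists U : set_system (seq T),
  UltraFilter U /\ forall k, U [set l | k \in l].
Proof.
pose F : set_system (seq T) :=
  [set V | exists l0 : seq T, forall l : seq T, {subset l0 <= l} -> V l].
have FF : ProperFilter F.
  apply: Build_ProperFilter_ex => [V [l0 l0V]|]; first by exists l0; exact: l0V.
  split; first by exists [::].
  - move=> V W [v vV] [w wW]; exists (v ++ w) => l vw; split.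
      by apply: vV => k kv; apply: vw; rewrite mem_cat kv.
    by apply: wW => k kw; apply: vw; rewrite mem_cat kw orbT.
  - by move=> V W VW [v vV]; exists v => l /vV/VW.
have [U [UU FU]] := ultraFilterLemma FF.
exists U; split=> // k; apply: FU; exists [:: k] => l; apply.
exact: mem_head.
Qed.

(* [R x d a] means that the element [d] of the ultraproduct [E] has a
   representative with value [a] at [x]. Since some [Ei x] may be empty,
   representatives are only defined almost everywhere. *)
Definition ultra_rep (X : Type) (U : set_system X) (Ei : X -> Type) (E : Type)
    (R : forall x, E -> Ei x -> Prop) : Prop :=
  [/\ forall d, U [set x | exists a, R x d a],
      forall x d a a', R x d a -> R x d a' -> a = a',
      forall d d', U [set x | exists2 a, R x d a & R x d' a] -> d = d' &
      forall P : forall x, Ei x -> Prop, U [set x | exists a, P x a] ->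
        exists d, U [set x | exists2 a, R x d a & P x a]].

Lemma ultraproduct_exists (X : Type) (U : set_system X) (FU : Filter U)
    (Ei : X -> Type) :
  exists (E : Type) (R : forall x, E -> Ei x -> Prop), ultra_rep U R.
Proof.
(* Elements are classes of partial functions defined almost everywhere, modulo equality almost
   everywhere; [elt] chooses a representative of each class. *)
pose F := {f : forall x, option (Ei x) | U [set x | f x]}.
pose eqF (f g : F) := U [set x | sval f x = sval g x].
have eqF_sym f g : eqF f g -> eqF g f by apply: filterS => x.
have eqF_trans f g h : eqF f g -> eqF g h -> eqF f h.
  by apply: filterS2 => x /= ->.
pose E := {C : set F | exists f, C = eqF f}.
pose elt (d : E) : F := projT1 (cid (proj2_sig d)).
have eltE d : sval d = eqF (elt d) by rewrite /elt; case: cid.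
exists E, (fun x d a => sval (elt d) x = Some a); split.
- move=> d; apply: filterS (proj2_sig (elt d)) => x /=.
  by case: (sval _ x) => // a _; exists a.
- by move=> x d a a' -> [].
- move=> d d' dd'; apply: eq_sig_hprop => [*|]; [exact: Prop_irrelevance|].
  change (sval d = sval d'); rewrite !eltE.
  have edd' : eqF (elt d) (elt d').
    by apply: filterS dd' => x [a] /= -> ->.
  by apply/seteqP; split=> f; apply: eqF_trans => //; exact: eqF_sym.
- move=> P HP.
  pose f x : option (Ei x) :=
    if pselect (exists a, P x a) is left h then Some (projT1 (cid h)) else None.
  have Uf : U [set x | f x].
    by apply: filterS HP => x /= h; rewrite /f; case: pselect.
  pose d : E := exist (fun C => exists f, C = eqF f) (eqF (exist _ f Uf))
    (ex_intro _ (exist _ f Uf) erefl).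
  exists d; have fd : eqF (exist _ f Uf) (elt d).
    have := eltE d; move: (elt d) => g /= ->; exact: filterS filterT.
  apply: filterS2 fd HP => x /= <- h; rewrite /f; case: pselect => // h'.
  by exists (projT1 (cid h')) => //; case: cid.
Qed.

Section UltraRep.
Variables (X : Type) (U : set_system X).
Context {UU : UltraFilter U}.

Lemma filterall (I : finType) (P : I -> set X) :
  (forall i, U (P i)) -> U [set x | forall i, P i x].
Proof. exact: filter_forall. Qed.

Definition ult (Ei : X -> Type) (E : Type) (R : forall x, E -> Ei x -> Prop)
    (d : E) (P : forall x, Ei x -> Prop) : Prop :=
  U [set x | exists2 a, R x d a & P x a].

Section Transfer.
Variables (Ei : X -> Type) (E : Type) (R : forall x, E -> Ei x -> Prop).
Arguments R : clear implicits.
Hypothesis ER : ultra_rep U R.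

(** Representatives exist almost everywhere and are unique, so the existential and the universal
    reading agree. *)
Lemma ult_all d (P : forall x, Ei x -> Prop) :
  ult R d P <-> U [set x | forall a, R x d a -> P x a].
Proof.
case: ER => Rtot Rfun _ _; split.
  by apply: filterS => x [a da Pa] b /(Rfun _ _ _ _ da) <-.
by apply: filterS2 (Rtot d) => x [a da] /(_ a da); exists a.
Qed.

Lemma ult_mono d (P Q : forall x, Ei x -> Prop) :
  (forall x a, P x a -> Q x a) -> ult R d P -> ult R d Q.
Proof. by move=> PQ; apply: filterS => x [a da /PQ]; exists a. Qed.

Lemma ult_not d (P : forall x, Ei x -> Prop) :
  ult R d (fun x a => ~ P x a) <-> ~ ult R d P.
Proof.
case: ER => Rtot Rfun _ _; split.
  move=> nP Pd; apply: (@filter_not_empty _ U).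
  by apply: filterS2 nP Pd => x [a da nPa] [b /(Rfun _ _ _ _ da) <-].
have [//|] := in_ultra_setVsetC [set x | exists2 a, R x d a & P x a] UU.
move=> nP _; apply: filterS2 (Rtot d) nP => x [a da] nPx.
by exists a => // Pa; apply: nPx; exists a.
Qed.

Lemma ult_and d (P Q : forall x, Ei x -> Prop) :
  ult R d (fun x a => P x a /\ Q x a) <-> ult R d P /\ ult R d Q.
Proof.
rewrite !ult_all; split; last by case; apply: filterS2 => x Px Qx a ad; split; auto.
by move=> PQ; split; apply: filterS PQ => x PQ a /PQ[].
Qed.

Lemma ult_const d d' :
  d = d' <-> U [set x | exists2 a, R x d a & R x d' a].
Proof.
case: ER => Rtot _ Req _; split=> [<-|]; last exact: Req.
by apply: filterS (Rtot d) => x [a]; exists a.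
Qed.

Lemma ult_ex (P : forall x, Ei x -> Prop) :
  U [set x | exists a, P x a] -> exists d, ult R d P.
Proof. by case: ER => _ _ _; apply. Qed.

End Transfer.

(** Finite families are represented componentwise, since finitely many sets of [U] intersect in a
    set of [U]. All lemmas about elements then apply to families and tuples. *)
Lemma ultra_rep_family (Ei : X -> Type) (E : Type)
    (R : forall x, E -> Ei x -> Prop) (J : finType) :
  ultra_rep U R ->
  ultra_rep U (fun x (d : J -> E) (a : J -> Ei x) => forall j, R x (d j) (a j)).
Proof.
move=> [Rtot Rfun Req Rch]; split.
- move=> d; apply: filterS (filterall (fun j => Rtot (d j))) => x /choice[a da].
  by exists a.
- by move=> x d a a' da da'; apply/funext => j; exact: Rfun (da j) (da' j).
- move=> d d' dd'; apply/funext => j; apply: Req.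
  by apply: filterS dd' => x [a da da']; exists (a j).
- move=> P HP.
  (* One witnessing family is fixed at each [x] before the components are lifted separately, so that
     the lifted components still belong to the same witness. *)
  pose f x : option (J -> Ei x) :=
    if pselect (exists a, P x a) is left h then Some (projT1 (cid h)) else None.
  have fP x a : f x = Some a -> P x a.
    by rewrite /f; case: pselect => // h [<-]; case: cid.
  have /choice[d Hd] : forall j : J, exists d, U [set x |
      exists2 b, R x d b & exists2 a, f x = Some a & b = a j].
    move=> j; apply: Rch; apply: filterS HP => x Px.
    rewrite /f /=; case: pselect => // h.
    by exists (projT1 (cid h) j); exists (projT1 (cid h)).
  exists d; apply: filterS2 HP (filterall Hd) => x Px Hx.
  have [a fa] : exists a, f x = Some a.
    by rewrite /f; case: pselect => // h; exists (projT1 (cid h)).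
  exists a; last exact: fP.
  move=> j; have [b db [a' fa' ba']] := Hx j.
  have -> : a = a' by apply: Some_inj; rewrite -fa -fa'.
  by rewrite -ba'.
Qed.

Lemma ult_injective (Ei : X -> Type) (E : Type)
    (R : forall x, E -> Ei x -> Prop) (J : finType) (d : J -> E) :
  ultra_rep U R -> injective d ->
  U [set x | forall a, (forall j, R x (d j) (a j)) -> injective a].
Proof.
move=> ER d_inj.
have H (p : J * J) : U [set x | p.1 != p.2 ->
    forall b, R x (d p.1) b -> ~ R x (d p.2) b].
  have [pp|pN] := eqVneq p.1 p.2; first exact: filterS filterT.
  have : ult R (d p.1) (fun x b => ~ R x (d p.2) b).
    apply/(ult_not ER) => /(ult_const ER) /d_inj pp.
    by rewrite pp eqxx in pN.
  by move=> /(ult_all ER); apply: filterS => x Hx _.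
apply: filterS (filterall H) => x Hx a da i j aij.
apply/eqP/negPn/negP => ij.
by apply: (Hx (i, j) ij (a i)) => //; rewrite aij.
Qed.

Definition reps (Ei : X -> Type) (E : Type) (R : forall x, E -> Ei x -> Prop)
    n x (d : n.-tuple E) (a : n.-tuple (Ei x)) : Prop :=
  forall i, R x (tnth d i) (tnth a i).

Lemma ultra_rep_tuple (Ei : X -> Type) (E : Type)
    (R : forall x, E -> Ei x -> Prop) n :
  ultra_rep U R -> ultra_rep U (@reps Ei E R n).
Proof.
move=> ER; have [Ftot Ffun Feq Fch] := ultra_rep_family 'I_n ER; split.
- move=> d; apply: filterS (Ftot (tnth d)) => x [a da].
  by exists [tuple a i | i < n] => i; rewrite tnth_mktuple.
- move=> x d a a' da da'; have aa' := Ffun x (tnth d) _ _ da da'.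
  by apply: eq_from_tnth => i; rewrite aa'.
- move=> d d' dd'; apply: eq_from_tnth => i.
  have -> // : tnth d = tnth d'.
  by apply: Feq; apply: filterS dd' => x [a]; exists (tnth a).
- move=> P HP; have [|d Hd] := Fch (fun x a => P x [tuple a i | i < n]).
    apply: filterS HP => x [a Pa]; exists (tnth a).
    by have -> : [tuple tnth a i | i < n] = a
      by apply: eq_from_tnth => i; rewrite tnth_mktuple.
  exists [tuple d i | i < n]; apply: filterS Hd => x [a da Pa].
  by exists [tuple a i | i < n] => // i; rewrite !tnth_mktuple.
Qed.

(** If every [P i] failed on a set of [U], all would fail together on one, by finiteness of [I]. *)
Lemma ultra_finite_choice (I : finType) (P : I -> X -> Prop) :
  U [set x | exists i, P i x] -> exists i, U [set x | P i x].
Proof.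
move=> HP; apply: contrapT => nP; apply: (@filter_not_empty _ U).
have H i : U [set x | ~ P i x].
  have [Pi|//] := in_ultra_setVsetC [set x | P i x] UU.
  by case: nP; exists i.
by apply: filterS2 HP (filterall H) => x [i Pi] /(_ i).
Qed.

End UltraRep.

(** * Los's theorem for active-domain semantics *)

Section Los.
Variables (S : signature) (X : Type) (U : set_system X).
Context {UU : UltraFilter U}.
Variables (Ei : X -> Type) (E : Type) (R : forall x, E -> Ei x -> Prop).
Arguments R : clear implicits.
Hypothesis ER : ultra_rep U R.

Let RT n := ultra_rep_tuple n ER.

Definition ultraproduct (I : forall x, instance S (Ei x)) : instance S E :=
  [set f | ult U (reps R (n := _)) (fact_args f) (fun x a => I x (Fact a))].

Lemma reps_map n m (e : n.-tuple E) (xs : m.-tuple 'I_n) x a :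
  reps R e a -> @reps _ _ _ R _ x (map_tuple (tnth e) xs) (map_tuple (tnth a) xs).
Proof. by move=> ea i; rewrite !tnth_map; exact: ea. Qed.

Lemma reps_cons n d (e : n.-tuple E) x b a :
  R x d b -> reps R e a -> @reps _ _ _ R _ x (cons_tuple d e) (cons_tuple b a).
Proof.
move=> db ea i; rewrite !(tnth_nth d) !(tnth_nth b) /=.
case: i => -[|i] //= lt_i; rewrite ltnS in lt_i.
by have := ea (Ordinal lt_i); rewrite (tnth_nth d) (tnth_nth b).
Qed.

Lemma reps_cat n m (e : n.-tuple E) (f : m.-tuple E) x a b :
  reps R e a -> reps R f b ->
  @reps _ _ _ R _ x (cat_tuple e f) (cat_tuple a b).
Proof.
move=> ea fb i; case: (split_ordP i) => j ->.
  by rewrite !tnth_lshift.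
by rewrite !tnth_rshift.
Qed.

Lemma ult_map n m (e : n.-tuple E) (xs : m.-tuple 'I_n) P :
  ult U (reps R (n := _)) (map_tuple (tnth e) xs) P <->
  ult U (reps R (n := _)) e (fun x a => P x (map_tuple (tnth a) xs)).
Proof.
split; last first.
  by apply: filterS => x [a /reps_map ea Pa]; exists (map_tuple (tnth a) xs).
move=> /(ult_all (RT _)) HP; apply/(ult_all (RT _)).
by apply: filterS HP => x HP a ea; apply/HP/reps_map.
Qed.

Lemma ultraproduct_Fact I (Rn : S) (t : (arity Rn).-tuple E) :
  ultraproduct I (Fact t) <-> ult U (reps R (n := _)) t (fun x a => I x (Fact a)).
Proof. by []. Qed.

Lemma ultraproductS (I J : forall x, instance S (Ei x)) :
  U [set x | I x `<=` J x] -> ultraproduct I `<=` ultraproduct J.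
Proof.
by move=> IJ f; apply: filterS2 IJ => x IJ [a fa /IJ]; exists a.
Qed.

Lemma adom_ultraproduct I d :
  adom (ultraproduct I) d <-> ult U R d (fun x => adom (I x)).
Proof.
split=> [[Rn [t [i [/ultraproduct_Fact It <-]]]]|].
  by apply: filterS It => x [a ta Ia]; exists (tnth a i); [exact: ta|exact: adom_Fact].
(* The relation and the position showing that a value is active may vary with [x]; as there are
   finitely many such pairs, one serves almost everywhere. *)
move=> Id; have [[Rn i] Hd] : exists p : {Rn : S & 'I_(arity Rn)}, U [set x |
    exists a : (arity (tag p)).-tuple (Ei x),
      I x (Fact a) /\ R x d (tnth a (tagged p))].
  apply: ultra_finite_choice; apply: filterS Id => x [b db [Rn [a [i [Ia ab]]]]].
  by exists (Tagged (fun Rn => 'I_(arity Rn)) i), a; rewrite ab.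
have [t Ht] := ult_ex (RT (arity Rn)) Hd.
exists Rn, t, i; split.
  by apply: filterS Ht => x [a ta [Ia _]]; exists a.
apply/(ult_const ER).
by apply: filterS Ht => x [a ta [_ da]]; exists (tnth a i).
Qed.

(** Quantifiers commute with the ultraproduct because its active domain is the ultraproduct of the
    active domains. *)
Lemma holds_ultraproduct I n (phi : fo S n) (e : n.-tuple E) :
  holds (ultraproduct I) phi e <->
  ult U (reps R (n := _)) e (fun x a => holds (I x) phi a).
Proof.
elim: phi e => {n} /=.
- by move=> n Rn xs e; exact: (ult_map e xs (fun x a => I x (Fact a))).
- move=> n i j e; rewrite (ult_const ER); split.
    move=> ij; apply/(ult_all (RT _)); apply: filterS ij => x [b ib jb] a ea.
    case: ER => _ Rfun _ _.
    by rewrite (Rfun _ _ _ _ (ea i) ib) (Rfun _ _ _ _ (ea j) jb).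
  by apply: filterS => x [a ea ij]; exists (tnth a i); rewrite // ij.
- move=> n e; split=> // _; apply/(ult_all (RT _)); exact: filterS filterT.
- by move=> n p IH e; rewrite IH (ult_not (RT _)).
- by move=> n p IHp q IHq e; rewrite IHp IHq (ult_and (RT _)).
- move=> n p IHp q IHq e; rewrite IHp IHq; split.
    by case; apply: ult_mono => x a; [left|right].
  move=> pq.
  have [|np] := pselect (ult U (reps R (n := _)) e (fun x => holds (I x) p)).
    by left.
  right; move: np => /(ult_not (RT _)) np.
  have /(ult_and (RT _)) := conj pq np.
  by apply: ult_mono => x a [[]].
- move=> n p IHp q IHq e; rewrite IHp IHq; split.
    move=> pq; have [/pq|/(ult_not (RT _))] :=
      pselect (ult U (reps R (n := _)) e (fun x => holds (I x) p)).
      by apply: ult_mono => x a.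
    by apply: ult_mono => x a.
  move=> pq p'; have /(ult_and (RT _)) := conj pq p'.
  by apply: ult_mono => x a []; apply.
- move=> n p IH e; split.
    move=> [d [/adom_ultraproduct Id /IH/(ult_all (RT _)) pd]].
    have [etot _ _ _] := RT n.
    apply: filterS2 (etot e) (filterI Id pd) => x [a ea] [[b db Ib] pb].
    by exists a => //; exists b; split=> //; apply/pb/reps_cons.
  move=> pe; have [|d Hd] := ult_ex ER (P := fun x b => adom (I x) b /\
      exists2 a, reps R e a & holds (I x) p (cons_tuple b a)).
    by apply: filterS pe => x [a ea [b [Ib pb]]]; exists b; split=> //; exists a.
  exists d; split.
    by apply/adom_ultraproduct; apply: ult_mono Hd => x b [].
  apply/IH; apply: filterS Hd => x [b db [_ [a ea pb]]].
  by exists (cons_tuple b a) => //; exact: reps_cons.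
- move=> n p IH e; split.
    (* Counterexamples present almost everywhere would assemble into one active element [d] refuting
       the formula. *)
    move=> pe; apply: contrapT => /(ult_not (RT _)) npe.
    have [|d Hd] := ult_ex ER (P := fun x b => adom (I x) b /\
        exists2 a, reps R e a & ~ holds (I x) p (cons_tuple b a)).
      apply: filterS npe => x [a ea /existsNP[b /not_implyP[Ib pb]]].
      by exists b; split=> //; exists a.
    have /IH/(ult_all (RT _)) pd : holds (ultraproduct I) p (cons_tuple d e).
      by apply: pe; apply/adom_ultraproduct; apply: ult_mono Hd => x b [].
    apply: (@filter_not_empty _ U).
    apply: filterS2 pd Hd => x pd [b db [_ [a ea]]]; apply.
    exact/pd/reps_cons.
  move=> pe d /adom_ultraproduct Id; apply/IH.
  apply: filterS2 Id pe => x [b db Ib] [a ea pb].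
  by exists (cons_tuple b a); [exact: reps_cons|exact: pb].
Qed.

Lemma models_ultraproduct I Sigma :
  (forall x, models (I x) Sigma) -> models (ultraproduct I) Sigma.
Proof.
move=> mI phi Sphi; apply/holds_ultraproduct.
apply: filterS filterT => x _; exists [tuple]; first by case.
exact: mI.
Qed.

Lemma all_atoms_ultraproduct I n (s : seq (fact S 'I_n)) (e : n.-tuple E) :
  all_atoms (ultraproduct I) s e <->
  ult U (reps R (n := _)) e (fun x a => all_atoms (I x) s a).
Proof.
elim: s => [|A s IHs] /=.
  split=> // _; have [etot _ _ _] := RT n.
  by apply: filterS (etot e) => x [a ea]; exists a.
rewrite IHs ultraproduct_Fact.
by rewrite (ult_map e (fact_args A) (fun x a => I x (Fact a))) -(ult_and (RT _)).
Qed.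

Lemma answers_ultraproduct (Q : cq S) I (c : (cq_free Q).-tuple E) :
  answers Q (ultraproduct I) c <->
  ult U (reps R (n := _)) c (fun x => answers Q (I x)).
Proof.
have [ctot cfun _ _] := RT (cq_free Q).
have [ytot yfun _ _] := RT (cq_bound Q).
split=> [[y [Iy /all_atoms_ultraproduct/(ult_all (RT _)) cy]]|].
  have Iy' := filterall (UU := UU) (fun j =>
    iffLR (adom_ultraproduct I (tnth y j)) (Iy j)).
  apply: filterS2 (filterI (ctot c) (ytot y)) (filterI Iy' cy).
  move=> x [[a ca] [b yb]] [xy xcy].
  exists a => //; exists b; split=> [j|]; last exact/xcy/reps_cat.
  have [b' jb' Ib'] := xy j; case: ER => _ Rfun _ _.
  by rewrite (Rfun _ _ _ _ (yb j) jb').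
move=> Qc; have [|y Hy] := ult_ex (RT (cq_bound Q)) (P := fun x b =>
    exists2 a, reps R c a & (forall j, adom (I x) (tnth b j)) /\
      all_atoms (I x) (cq_atoms Q) (cat_tuple a b)).
  by apply: filterS Qc => x [a ca [b]]; exists b; exists a.
exists y; split=> [j|].
  apply/adom_ultraproduct; apply: filterS Hy => x [b yb [a _ [Ib _]]].
  by exists (tnth b j).
apply/all_atoms_ultraproduct; apply: filterS Hy => x [b yb [a ca [_ ab]]].
by exists (cat_tuple a b) => //; exact: reps_cat.
Qed.

End Los.

(** * From determinacy to plans *)

Lemma all_atomsS (S : signature) (D : Type) (I J : instance S D) n
    (s : seq (fact S 'I_n)) (e : n.-tuple D) :
  I `<=` J -> all_atoms I s e -> all_atoms J s e.
Proof. by move=> IJ; elim: s => //= A s IHs [/IJ ? /IHs]. Qed.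

Lemma all_atoms_directed (S : signature) (D W : Type) (w0 : W)
    (A : W -> instance S D) n (s : seq (fact S 'I_n)) (e : n.-tuple D) :
  (forall v w, exists u, A v `<=` A u /\ A w `<=` A u) ->
  all_atoms (\bigcup_w A w) s e -> exists w, all_atoms (A w) s e.
Proof.
move=> dirA; elim: s => [|B s IHs] /=; first by exists w0.
move=> [[v _ vB] /IHs[w ws]]; have [u [vu wu]] := dirA v w.
by exists u; split; [exact: vu|exact: all_atomsS ws].
Qed.

(** * Closure under accesses in an ultraproduct *)

Section AccessClosedUltraproduct.
Variables (Sch : schema) (X : Type) (U : set_system X).
Context {UU : UltraFilter U}.
Variables (Ei : X -> Type) (E : Type) (R : forall x, E -> Ei x -> Prop).
Arguments R : clear implicits.
Hypothesis ER : ultra_rep U R.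
Variables (I : forall x, instance Sch (Ei x)) (sigma : forall x, selection Sch (Ei x)).
Arguments I : clear implicits.
Arguments sigma : clear implicits.
Hypothesis valid_sigma : forall x, valid_selection (I x) (sigma x).
Arguments valid_sigma : clear implicits.

(** The ultraproduct is taken for a fixed list [w], and the union over [w] only afterwards: any
    finite part of that union lies in one ultralayer and is thus within reach of a single
    pattern. *)
Definition ultralayer w : instance Sch E :=
  ultraproduct U R (fun x => layer (sigma x) w).

Lemma ultralayer_directed v w : exists u,
  ultralayer v `<=` ultralayer u /\ ultralayer w `<=` ultralayer u.
Proof.
exists (v ++ w); split; apply: ultraproductS; apply: filterS filterT => x _.
  exact: layer_prefix.
exact: layer_suffix.
Qed.

(** A binding over the union lies in one ultralayer [w]. Almost everywhere it is represented by a
    binding over layer [w], whose output lies in layer [mt :: w]. *)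
Lemma access_closed_ultraproduct :
  access_closed (ultraproduct U R I) (\bigcup_w ultralayer w).
Proof.
move=> mt b Ab.
have [w wb] := adom_directed [::] ultralayer_directed Ab.
have [Rtot Rfun Req Rch] := ER.
have RT : ultra_rep U (@reps _ _ _ R (method_arity mt)) by exact: ultra_rep_tuple.
have Ub : U [set x | exists b' : binding (Ei x) mt,
    [/\ forall i, R x (b i) (b' i),
        valid_output (method_bound mt) (matching (I x) b') (sigma x mt b') &
        forall t, sigma x mt b' t -> layer (sigma x) (mt :: w) (Fact t)]].
  have wb' := filterall (UU := UU) (fun i => iffLR
    (adom_ultraproduct (UU := UU) ER (fun x => layer (sigma x) w) (b i)) (wb i)).
  apply: filterS wb' => x Hx.
  have /choice[b0 Hb] : forall i, exists a, R x (b i) a /\ adom (layer (sigma x) w) a.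
    by move=> i; have [a] := Hx i; exists a.
  have wb0 i : adom (layer (sigma x) w) ((finfun b0 : binding (Ei x) mt) i).
    by rewrite ffunE; exact: (Hb i).2.
  exists (finfun b0); split.
  - by move=> i; rewrite ffunE; exact: (Hb i).1.
  - have Iw : layer (sigma x) w `<=` I x := layer_sub (valid_sigma x).
    by apply: valid_sigma => i; apply: (adomS Iw); exact: wb0.
  - by move=> t bt; right; exists (finfun b0); split=> //; exists t.
have matchE x (b' : binding (Ei x) mt) t a :
    (forall i, R x (b i) (b' i)) -> reps R t a ->
    (forall i : input_pos mt, tnth t (val i) = b i) ->
    forall i : input_pos mt, tnth a (val i) = b' i.
  by move=> bb' ta tb i; apply: Rfun (bb' i); rewrite -tb; exact: ta.
(* For a fixed [j], having [j] distinct elements transfers in both directions: [j] matching tuples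
   of the ultraproduct give [j] matching tuples at [x], hence [j] outputs there, and these assemble
   into [j] distinct tuples of the ultralayer. *)
have lower k : U [set x | forall b' : binding (Ei x) mt,
      (forall i, R x (b i) (b' i)) ->
      valid_output (method_bound mt) (matching (I x) b') (sigma x mt b') ->
      meets_lower k (matching (I x) b') (sigma x mt b')] ->
    meets_lower k (matching (ultraproduct U R I) b)
      (matching (\bigcup_w ultralayer w) b).
  move=> Uk j jk /card_ge_IP[F F_inj IF].
  have FR := ultra_rep_family (UU := UU) 'I_j RT.
  have UF := filterall (UU := UU) (fun i => iffLR (ult_all (UU := UU) RT _ _) (IF i).1).
  have [Ftot Ffun Feq _] := FR.
  have [|G HG] := ult_ex FR (P := fun x (g : 'I_j -> _) => injective g /\
      exists2 b' : binding (Ei x) mt, forall i, R x (b i) (b' i) &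
      forall i, matching (layer (sigma x) (mt :: w)) b' (g i)).
    apply: filterS2 (filterI UF Uk) (filterI Ub
      (filterI (ult_injective RT F_inj) (Ftot F))).
    move=> x [UFx Ukx] [[b' [bb' vb' lb']] [Fx [f Ff]]].
    have /card_ge_IP[g g_inj sg] : `I_j #<= sigma x mt b'.
      apply: (Ukx b' bb' vb' j jk); apply/card_ge_IP.
      exists f; first exact: Fx.
      move=> i; split; first exact: UFx (Ff i).
      exact: matchE bb' (Ff i) (IF i).2.
    exists g; split=> //; exists b' => // i; split; first exact: lb'.
    by have [] := vb'.1 _ (sg i).
  apply/card_ge_IP; exists G => [i i' Gii'|i].
    have [x [g Gg [g_inj _]]] := filter_ex HG.
    apply: g_inj; have [_ Tfun _ _] := RT.
    by apply: Tfun (Gg i) _; rewrite Gii'; exact: Gg.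
  split.
    exists (mt :: w) => //; apply: filterS HG => x [g Gg [_ [b' _ gb]]].
    by exists (g i); [exact: Gg|exact: (gb i).1].
  move=> l; apply: Req; apply: filterS HG => x [g Gg [_ [b' bb' gb]]].
  by exists (b' l) => //; rewrite -(gb i).2; exact: Gg.
case Emt : (method_bound mt) => [|k k0|k] /=.
- move=> t [It tb]; split=> //; exists (mt :: w) => //.
  apply: filterS2 It Ub => x [a ta Ia] [b' [bb' [_ vb'] lb']].
  exists a => //; apply: lb'; move: vb'; rewrite Emt => ->.
  by split=> //; exact: matchE bb' ta tb.
- by apply: lower; apply: filterS filterT => x _ b' _; rewrite Emt => -[_ []].
- by apply: lower; apply: filterS filterT => x _ b' _; rewrite Emt => -[].
Qed.

End AccessClosedUltraproduct.

(** * The counterexample obtained when no plan exists *)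

Section Completeness.
Variables (Sch : schema) (Q : cq Sch).

Definition sound_pattern (p : pattern Sch (cq_free Q)) : Prop :=
  forall D (I : instance Sch D) (sigma : selection Sch D),
    models I (constraints Sch) -> valid_selection I sigma ->
    pattern_answers p sigma `<=` answers Q I.

Local Notation sound := {classic {p | sound_pattern p}}.

Record missed_answer (l : seq sound) := MissedAnswer {
  ma_dom : Type;
  ma_inst : instance Sch ma_dom;
  ma_sel : selection Sch ma_dom;
  ma_tuple : (cq_free Q).-tuple ma_dom;
  ma_models : models ma_inst (constraints Sch);
  ma_valid : valid_selection ma_inst ma_sel;
  ma_answer : answers Q ma_inst ma_tuple;
  ma_missed : forall k, k \in l -> ~ pattern_answers (sval k) ma_sel ma_tuple }.

Arguments ma_inst {l} m _.
Arguments ma_sel {l} m mt _ _.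
Arguments ma_models {l} m _ _.
Arguments ma_valid {l} m mt b _.
Arguments ma_answer {l} m.
Arguments ma_missed {l} m k _ _.

(** The union of the patterns in [l] is computed by a plan and is sound; if it missed no answer,
    that plan would answer [Q]. *)
Lemma missed_answer_exists (l : seq sound) :
  ~ monotone_answerable Q -> inhabited (missed_answer l).
Proof.
move=> nQ; apply: contrapT => nl; apply: nQ.
have [P PE] := computed_plan (computed_patterns (fun k : sound => sval k) l).
have out D (I : instance Sch D) s : models I (constraints Sch) ->
    valid_selection I s -> plan_eval s P tt = answers Q I.
  move=> mI vs; rewrite PE; apply/seteqP; split=> [c [k _]|c Qc].
    exact: (proj2_sig k) mI vs c.
  apply: contrapT => nc; apply: nl; constructor.
  apply: (@MissedAnswer l D I s c) => // k kl kc; apply: nc; by exists k.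
exists P => D I mI; apply/seteqP; split=> [_ [s vs <-]|_ ->]; first exact: out.
(* The set of possible outputs is nonempty because a valid selection exists. *)
by have [s vs] := valid_selection_exists I; exists s => //; exact: out.
Qed.

(** The data [e], [s], [h] present a finite part of [A] together with [c] as a pattern, with
    distinct variables for distinct values. *)
Definition locally_refutable (D : Type) (A : instance Sch D)
    (c : (cq_free Q).-tuple D) : Prop :=
  forall m (e : m.-tuple D) (s : seq (fact Sch 'I_m)) (h : (cq_free Q).-tuple 'I_m),
    injective (tnth e) -> (forall i, adom A (tnth e i)) ->
    all_atoms A s e -> c = map_tuple (tnth e) h ->
  exists (D2 : Type) (I2 : instance Sch D2) (e2 : m.-tuple D2),
    [/\ models I2 (constraints Sch), injective (tnth e2), all_atoms I2 s e2 &
        ~ answers Q I2 (map_tuple (tnth e2) h)].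

Lemma unanswerable_counterexample :
  ~ monotone_answerable Q ->
  exists (D : Type) (I A : instance Sch D) (c : (cq_free Q).-tuple D),
    [/\ models I (constraints Sch), A `<=` I, access_closed I A, answers Q I c &
        locally_refutable A c].
Proof.
move=> nQ.
have [U [UU Ucone]] := ultrafilter_cones sound.
have ma l : missed_answer l.
  apply: (projT1 (cid (P := fun=> True) _)).
  by have [x] := missed_answer_exists l nQ; exists x.
pose Ei l := ma_dom (ma l).
have [E [R ER]] := ultraproduct_exists (U := U) _ Ei.
pose I l : instance Sch (Ei l) := ma_inst (ma l).
pose sigma l : selection Sch (Ei l) := ma_sel (ma l).
have vsigma l : valid_selection (I l) (sigma l) := ma_valid (ma l).
have RT := fun n => ultra_rep_tuple (UU := UU) n ER.
have [|c Hc] := ult_ex (RT (cq_free Q)) (P := fun l a => answers Q (I l) a /\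
    forall k, k \in l -> ~ pattern_answers (sval k) (sigma l) a).
  apply: filterS filterT => l _; exists (ma_tuple (ma l)).
  by split; [exact: ma_answer|exact: ma_missed].
pose L := ultralayer U R sigma.
exists E, (ultraproduct U R I), (\bigcup_w L w), c; split.
- by apply: (models_ultraproduct ER) => l; exact: ma_models.
- move=> f [w _]; apply: ultraproductS f; apply: filterS filterT => l _.
  exact: layer_sub (vsigma l).
- exact: (access_closed_ultraproduct ER vsigma).
- by apply/(answers_ultraproduct ER); apply: ult_mono Hc => l a [].
move=> m e s h e_inj Ae As ce.
have dirL := ultralayer_directed (UU := UU) R sigma.
have [w1 ew1] := adom_directed [::] dirL Ae.
have [w2 sw2] := all_atoms_directed [::] dirL As.
have [w [w1w w2w]] := dirL w1 w2.
(* If [p] is unsound, its failure on some model is the required refutation. *)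
pose p := Pattern w s h.
have [sp|/existsNP[D2 /existsNP[I2 /existsNP[s2 /not_implyP[m2 /not_implyP[v2]]]]]] :=
  pselect (sound_pattern p); last first.
  move=> /existsNP[c2 /not_implyP[[e2 [ae2 e2_inj se2] <-] nQ2]].
  exists D2, I2, e2; split=> //.
  exact: all_atomsS (layer_sub v2) se2.
(* If [p] is sound, almost all lists [l] contain it; but the representatives of [e] show that [p]
   finds [c] at almost all [l], where all patterns of [l] miss it. *)
exfalso; apply: (@filter_not_empty _ U).
have [_ Rfun _ _] := ER; have [etot _ _ _] := RT m.
have [_ cfun _ _] := RT (cq_free Q).
have Ue := filterall (UU := UU) (fun i => iffLR
  (adom_ultraproduct (UU := UU) ER (fun l => layer (sigma l) w) (tnth e i))
  (adomS w1w (ew1 i))).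
have Us := iffLR (ult_all (UU := UU) (RT m) _ _)
  (iffLR (all_atoms_ultraproduct (UU := UU) ER _ _ _) (all_atomsS w2w sw2)).
apply: filterS2 (filterI Hc (Ucone (exist _ p sp)))
  (filterI (filterI Ue Us) (filterI (etot e) (ult_injective ER e_inj))).
move=> l [[c' cc' [_ nc']] pl] [[ael sel] [[a ea] ainj]].
apply: (nc' _ pl); exists a; first split=> //.
- by move=> i; have [b ib ab] := ael i; rewrite (Rfun _ _ _ _ (ea i) ib).
- exact: ainj.
- exact: sel.
- by apply: (cfun l c _ _ _ cc'); rewrite ce; exact: reps_map.
Qed.

End Completeness.

(** * Local refutations contradict determinacy *)

Section Refutation.
Variables (Sch : schema) (Q : cq Sch) (D : Type) (A : instance Sch D).
Variable c : (cq_free Q).-tuple D.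

Local Notation fact_in := {classic {f | A f}}.

(** The embedding [pm_rel] is a relation because it is defined only on the finitely many values that
    matter for [s] and [c]. *)
Record partial_model (s : seq fact_in) := PartialModel {
  pm_dom : Type;
  pm_inst : instance Sch pm_dom;
  pm_rel : D -> pm_dom -> Prop;
  pm_models : models pm_inst (constraints Sch);
  pm_fun : forall x y y', pm_rel x y -> pm_rel x y' -> y = y';
  pm_inj : forall x x' y, pm_rel x y -> pm_rel x' y -> x = x';
  pm_fact : forall f : fact_in, f \in s -> exists2 u,
    forall i, pm_rel (tnth (fact_args (sval f)) i) (tnth u i) &
    pm_inst (Fact u);
  pm_refutes : exists2 u, forall i, pm_rel (tnth c i) (tnth u i) &
    ~ answers Q pm_inst u }.

Arguments pm_inst {s} p _.
Arguments pm_rel {s} p _ _.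
Arguments pm_models {s} p _ _.
Arguments pm_fun {s} p x y y' _ _.
Arguments pm_inj {s} p x x' y _ _.
Arguments pm_fact {s} p f _.
Arguments pm_refutes {s} p.

Lemma partial_model_exists (s : seq fact_in) :
  (forall i, adom A (tnth c i)) -> locally_refutable A c ->
  inhabited (partial_model s).
Proof.
move=> Ac refA.
pose args (f : fact_in) : seq {classic D} := fact_args (sval f).
pose vs : seq {classic D} := undup (flatten (map args s) ++ c).
have vs_adom x : x \in vs -> adom A x.
  rewrite mem_undup mem_cat => /orP[/flatten_mapP[[[R t] At] _]|].
    by move=> /(@tnthP _ {classic D} t x)[i ->]; exact: adom_Fact At i.
  by move=> /(@tnthP _ {classic D} c x)[i ->].
pose e : (size vs).-tuple D := in_tuple vs.
have e_inj : injective (tnth e).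
  by apply/(@tuple_uniqP _ {classic D} e); exact: undup_uniq.
have index k (u : k.-tuple D) : (forall i, (tnth u i : {classic D}) \in vs) ->
    exists xs, map_tuple (tnth e) xs = u.
  move=> uv; have [i|xs Hxs] := tuple_choice (P := fun i j => tnth e j = tnth u i).
    by have /seq_tnthP[j ->] := uv i; exists j.
  by exists xs; apply: eq_from_tnth => i; rewrite tnth_map.
have [h hc] : exists h, map_tuple (tnth e) h = c.
  apply: index => i; rewrite mem_undup mem_cat; apply/orP; right.
  exact: (@mem_tnth _ {classic D} i c).
(* The facts in [s] become atoms over the indices of their values in [vs]. *)
have [s' As' Hs'] : exists2 s' : seq (fact Sch 'I_(size vs)), all_atoms A s' e &
    forall D2 (I2 : instance Sch D2) e2, all_atoms I2 s' e2 ->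
    forall f : fact_in, f \in s -> exists2 xs,
      map_tuple (tnth e) xs = fact_args (sval f) &
      I2 (Fact (map_tuple (tnth e2) xs)).
  have: {subset s <= s} by [].
  elim: {1 3}s => [|f r IHr] rs; first by exists [::].
  have [|s' As' Hs'] := IHr; first by move=> g gr; apply: rs; rewrite inE gr orbT.
  have [|xs xsf] := index _ (fact_args (sval f)).
    move=> i; rewrite mem_undup mem_cat; apply/orP; left.
    apply/flatten_mapP; exists f; first by apply: rs; exact: mem_head.
    exact: (@mem_tnth _ {classic D} i (fact_args (sval f))).
  exists (Fact xs :: s').
    by split=> //=; rewrite /fact_args /= xsf; case: (f) => -[].
  move=> D2 I2 e2 /= [I2f I2s'] g; rewrite inE => /predU1P[->|gr].
    by exists xs.
  exact: Hs' I2s' _ gr.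
have [|D2 [I2 [e2 [m2 e2_inj se2 nQ2]]]] := refA _ e s' h e_inj _ As' (esym hc).
  by move=> i; apply: vs_adom; exact: mem_tnth.
constructor; apply: (@PartialModel s D2 I2
  (fun x y => exists2 i, tnth e i = x & tnth e2 i = y)) => //.
- by move=> x y y' [i ix <-] [j jx <-]; congr tnth; apply: e_inj; rewrite ix.
- by move=> x x' y [i <- iy] [j <- jy]; congr tnth; apply: e2_inj; rewrite iy.
- move=> f fs; have [xs xsf I2f] := Hs' _ _ _ se2 f fs.
  exists (map_tuple (tnth e2) xs) => // i.
  by exists (tnth xs i); rewrite ?tnth_map // -xsf tnth_map.
- exists (map_tuple (tnth e2) h) => // i.
  by exists (tnth h i); rewrite ?tnth_map // -hc tnth_map.
Qed.

Lemma amondet_not_refutable (I : instance Sch D) :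
  amondet Q -> models I (constraints Sch) -> A `<=` I -> access_closed I A ->
  answers Q I c -> ~ locally_refutable A c.
Proof.
move=> mdQ mI AI cA Qc refA.
(* Two copies of [I] sharing only the values of [A] are amalgamated: [c] is then an answer on both
   copies, so its entries are shared. *)
have Ac : forall i, adom A (tnth c i).
  have [||R t At|u [cu _] i] := @amondet_amalgam _ _ _ _ I A I
    (fun x y => x = y /\ adom A x) mdQ mI mI AI cA _ _ _ c Qc.
  - by move=> x y y' [<- _] [].
  - by move=> x x' y [-> _] [->].
  - exists t; split; last exact: AI.
    by move=> i; split=> //; exact: adom_Fact.
  by have [] := cu i.
have [U [UU Ucone]] := ultrafilter_cones fact_in.
have pm s : partial_model s.
  apply: (projT1 (cid (P := fun=> True) _)).
  by have [x] := partial_model_exists s Ac refA; exists x.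
have [E [R ER]] := ultraproduct_exists (U := U) _ (fun s => pm_dom (pm s)).
have [_ Rfun Req _] := ER; have RT := fun n => ultra_rep_tuple (UU := UU) n ER.
have ult_rel n (t : n.-tuple D) u :
    ult U (reps R (n := n)) u (fun s a =>
      forall i, pm_rel (pm s) (tnth t i) (tnth a i)) ->
    forall i, ult U R (tnth u i) (fun s => pm_rel (pm s) (tnth t i)).
  by move=> Hu i; apply: filterS Hu => s [a ua ta]; exists (tnth a i).
(* The partial embeddings combine into one defined on all of [A], since each fact of [A] is embedded
   at almost all [s]. The image of [c] is then an answer on the ultraproduct although it is refuted
   at every index. *)
have [|||R0 t At|u [cu Qu]] := @amondet_amalgam _ _ _ _ I A
  (ultraproduct U R (fun s => pm_inst (pm s)))
  (fun x y => ult U R y (fun s => pm_rel (pm s) x)) mdQ mI _ AI cA _ _ _ c Qc.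
- by apply: (models_ultraproduct ER) => s; exact: pm_models.
- move=> x y y' xy xy'; apply: Req; apply: filterS2 xy xy' => s [a ya xa] [b yb xb].
  by exists a => //; rewrite (pm_fun _ _ _ _ xa xb).
- move=> x x' y xy xy'; have [s [[a ya xa] [b yb xb]]] := filter_ex (filterI xy xy').
  by apply: pm_inj xa _; rewrite (Rfun _ _ _ _ ya yb).
- have [|u Hu] := ult_ex (RT (arity R0)) (P := fun s a =>
      (forall i, pm_rel (pm s) (tnth t i) (tnth a i)) /\ pm_inst (pm s) (Fact a)).
    apply: filterS (Ucone (exist _ _ At)) => s /(pm_fact (pm s))[u tu Iu].
    by exists u.
  exists u; split; last by apply: ult_mono Hu => s a [].
  by apply: ult_rel; apply: ult_mono Hu => s a [].
- have := iffLR (answers_ultraproduct (UU := UU) ER _ _) Qu.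
  move=> Qu'; apply: (@filter_not_empty _ U).
  apply: filterS2 (filterall (UU := UU) cu) Qu' => s cs [a ua Qa].
  have [b cb nQb] := pm_refutes (pm s); apply: nQb.
  have -> // : b = a.
  apply: eq_from_tnth => i; have [x ux cx] := cs i.
  by rewrite (Rfun _ _ _ _ (ua i) ux); exact: pm_fun (cb i) cx.
Qed.

End Refutation.

Theorem theorem4p2 : forall (Sch : schema) (Q : cq Sch),
  monotone_answerable Q <-> amondet Q.
Proof.
move=> Sch Q; split; first exact: answerable_amondet.
move=> mdQ; apply: contrapT => nQ.
have [D [I [A [c [mI AI cA Qc]]]]] := unanswerable_counterexample nQ.
exact: amondet_not_refutable mdQ mI AI cA Qc.
Qed.
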